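(* Let $\varepsilon\in(0,1/2)$. Suppose that $E(Y^2)<\infty$, $E(\|X\|^2)<\infty$, $V(Y)>0$, $V(X)$ is non-singular, and $E(Y|X)=\alpha_0+X'\beta_0$ for some $(\alpha_0,\beta_0)\in\mathbb{R}\times\mathbb{R}^p$. Suppose also that we observe $(Y_1,\dots,Y_{n_Y})$ and $(X_1,\dots,X_{n_X})$, two independent samples of i.i.d. variables with the same distribution as $Y$ and $X$, respectively. Then, as $n:=n_Xn_Y/(n_X+n_Y)\to\infty$, $$d_H\left(\widehat{\mathcal{B}}_\varepsilon,\mathcal{B}_\varepsilon\right)\overset{\mathbb{P}}{\longrightarrow}0.$$
   Context: $Y$ is a real random variable, $X$ a random vector in $\mathbb{R}^p$; $V(\cdot)$ is the variance (matrix), $\mathcal{S}$ the unit sphere of $\mathbb{R}^p$, $F_A$ the cdf of $A$, $A_0:=A-E(A)$ for integrable $A$. For a cdf $F$ on $\mathbb{R}$, $F^{-1}(t)=\inf\{x:F(x)\ge t\}$. For mean-zero cdfs $F,G$ and $\alpha\in(0,1)$, $$R(\alpha,F,G)=\frac{\int_\alpha^1F^{-1}(t)dt}{\int_\alpha^1G^{-1}(t)dt},\qquad S_\varepsilon(F,G)=\min_{\alpha\in[\varepsilon,1-\varepsilon]}R(\alpha,F,G).$$ Let $\mathcal{B}_\varepsilon=\{\lambda q:q\in\mathcal{S},\ 0\le\lambda\le S_\varepsilon(F_{Y_0},F_{X_0'q})\}$. Let $\widehat F_Y$ and $\widehat F_{X'q}$ be the empirical cdfs of $(Y_i)_{i\le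 n_Y}$ and $(X_i'q)_{i\le n_X}$, $\overline Y$ and $\overline X$ the sample means, $\widehat F_{Y_0}(t)=\widehat F_Y(t+\overline Y)$, $\widehat F_{X_0'q}(t)=\widehat F_{X'q}(t+\overline X'q)$, and $\widehat{\mathcal{B}}_\varepsilon=\{\lambda q:q\in\mathcal{S},\ 0\le\lambda\le S_\varepsilon(\widehat F_{Y_0},\widehat F_{X_0'q})\}$. $d_H$ is the Hausdorff distance: $d_H(C,C')=\max\left(\sup_{c'\in C'}\inf_{c\in C}\|c-c'\|,\ \sup_{c\in C}\inf_{c'\in C'}\|c-c'\|\right)$. *)

(* Defs.v *)
From HB Require Import structures.
From mathcomp Require Import all_boot all_order all_algebra finmap.
From mathcomp Require Import all_classical all_reals all_analysis.
From mathcomp Require Import measurable_realfun.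
Import Order.TTheory GRing.Theory Num.Theory.
Import numFieldNormedType.Exports.

Set Implicit Arguments.
Unset Strict Implicit.
Unset Printing Implicit Defensive.

Local Open Scope classical_set_scope.
Local Open Scope ring_scope.

Section euclidean.
Context {R : realType} {p : nat}.

Definition dot (u v : 'rV[R]_p) : R := \sum_(j < p) u 0 j * v 0 j.

(* The library norm on ['rV[R]_p] is the sup norm, hence this definition. *)
Definition enorm (u : 'rV[R]_p) : R := Num.sqrt (dot u u).

(* Values in [\bar R]: the distance to an unbounded set may be [+oo]. *)
Definition hausdorff (C C' : set 'rV[R]_p) : \bar R :=
  maxe
    (ereal_sup [set ereal_inf [set (enorm (c - c'))%:E | c in C] | c' in C'])
    (ereal_sup [set ereal_inf [set (enorm (c - c'))%:E | c' in C'] | c in C]).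

(* Random vectors take values in [p.-tuple R], which carries the product
   sigma-algebra in the library; [rowt] moves them to the vector space. *)
Definition rowt (x : p.-tuple R) : 'rV[R]_p := \row_j tnth x j.

End euclidean.

Section quantile_ratio.
Context {R : realType}.

Definition quantile (F : R -> R) (t : R) : R := inf [set x | t <= F x].

Definition tail_integral (alpha : R) (F : R -> R) : R :=
  \int[lebesgue_measure]_(t in `[alpha, 1]) quantile F t.

Definition ratioR (alpha : R) (F G : R -> R) : R :=
  tail_integral alpha F / tail_integral alpha G.

(* [ratioR] is continuous in [alpha] on the compact interval [eps, 1 - eps]
   when [G] is the cdf of a nondegenerate centered law, and [inf] is then the
   minimum.  If [G] is degenerate at 0, then [ratioR] is [_ / 0 = 0]. *)
Definition Seps (eps : R) (F G : R -> R) : R :=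
  inf [set ratioR alpha F G | alpha in `[eps, 1 - eps]].

(* [G q] stands for the cdf attached to the direction [q]. *)
Definition Bset {p} (eps : R) (F : R -> R) (G : 'rV[R]_p -> R -> R) :
    set 'rV[R]_p :=
  [set v | exists (lam : R) (q : 'rV[R]_p),
     [/\ enorm q = 1, 0 <= lam <= Seps eps F (G q) & v = lam *: q]].

End quantile_ratio.

Section population.
Context {R : realType} {d : measure_display} {T : measurableType d}.
Variable P : probability T R.

Definition centered (A : T -> R) (w : T) : R := A w - fine 'E_P[A].

Lemma measurable_centered (A : {RV P >-> R}) : measurable_fun setT (centered A).
Proof. exact: measurable_funB. Qed.

HB.instance Definition _ (A : {RV P >-> R}) :=
  isMeasurableFun.Build _ _ _ _ (centered A) (measurable_centered A).

Context {p : nat}.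

Definition coord (X : T -> p.-tuple R) (j : 'I_p) (w : T) : R := tnth (X w) j.

Definition mean_vec (X : T -> p.-tuple R) : 'rV[R]_p :=
  \row_j fine 'E_P[coord X j].

Definition cov_mx (X : T -> p.-tuple R) : 'M[R]_p :=
  \matrix_(i, j) fine (covariance P (coord X i) (coord X j)).

Definition center_dot (X : T -> p.-tuple R) (q : 'rV[R]_p) (w : T) : R :=
  dot (rowt (X w) - mean_vec X) q.

Lemma measurable_center_dot (X : {RV P >-> p.-tuple R}) (q : 'rV[R]_p) :
  measurable_fun setT (center_dot X q).
Proof.
apply: measurable_sum => j; apply: measurable_funM => //.
rewrite (_ : (fun _ => _) = coord X j \- cst (mean_vec X 0 j)); last first.
  by apply/funext => w; rewrite !mxE.
apply: measurable_funB => //.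
exact: (measurableT_comp (measurable_tnth j)).
Qed.

HB.instance Definition _ (X : {RV P >-> p.-tuple R}) (q : 'rV[R]_p) :=
  isMeasurableFun.Build _ _ _ _ (center_dot X q) (measurable_center_dot X q).

Definition cdfR (A : {RV P >-> R}) (t : R) : R := fine (cdf A t).

Definition Bpop (eps : R) (Y : {RV P >-> R}) (X : {RV P >-> p.-tuple R}) :
    set 'rV[R]_p :=
  Bset eps (cdfR (centered Y : {RV P >-> R}))
    (fun q => cdfR (center_dot X q : {RV P >-> R})).

End population.

Section empirical.
Context {R : realType}.

Definition ecdf (n : nat) (a : nat -> R) (t : R) : R :=
  n%:R^-1 * \sum_(i < n) (a i <= t)%R%:R.

Definition smean {V : lmodType R} (n : nat) (a : nat -> V) : V :=
  n%:R^-1 *: \sum_(i < n) a i.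

Definition Bhat {p} (eps : R) (nY nX : nat) (y : nat -> R)
    (x : nat -> 'rV[R]_p) : set 'rV[R]_p :=
  Bset eps
    (fun t => ecdf nY y (t + smean nY (y : nat -> R^o)))
    (fun q t => ecdf nX (fun i => dot (x i) q) (t + dot (smean nX x) q)).

End empirical.

Section conditioning_independence.
Context {R : realType} {d : measure_display} {T : measurableType d}.
Variable P : probability T R.

Definition sigma_of {d' : measure_display} {T' : measurableType d'}
    (X : T -> T') : set (set T) :=
  preimage_set_system setT X measurable.

Definition is_cond_exp {d' : measure_display} {T' : measurableType d'}
    (Y : T -> R) (X : T -> T') (g : T -> R) : Prop :=
  [/\ sigma_of g `<=` sigma_of X,
      P.-integrable setT (EFin \o g) &
      forall A, sigma_of X A ->
        (\int[P]_(w in A) (Y w)%:E = \int[P]_(w in A) (g w)%:E)%E].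

Definition mutually_independent {d' : measure_display} {T' : measurableType d'}
    (Z : nat -> T -> T') : Prop :=
  forall (J : {fset nat}) (B : nat -> set T'),
    (forall i, measurable (B i)) ->
    P (\bigcap_(i in [set` J]) (Z i @^-1` B i)) =
    (\prod_(i <- J) P (Z i @^-1` B i))%E.

Definition sigma_of_seq {d' : measure_display} {T' : measurableType d'}
    (Z : nat -> T -> T') : set (set T) :=
  <<s \bigcup_i sigma_of (Z i) >>.

Definition independent_sigma (F G : set (set T)) : Prop :=
  forall A B, F A -> G B -> P (A `&` B) = (P A * P B)%E.

(* Convergence to 0 in (outer) probability: [P^*] is the outer measure of [P],
   which agrees with [P] on events. *)
Definition cvg_prob0 (D : nat -> T -> \bar R) : Prop :=
  forall delta : R, 0 < delta ->
    (P^*)%mu [set w | (delta%:E < D k w)%E] @[k --> \oo] --> (0 : \bar R).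

End conditioning_independence.

Definition same_law {R : realType} {d d1 d2 : measure_display}
    {T1 : measurableType d1} {T2 : measurableType d2} {T' : measurableType d}
    (P1 : probability T1 R) (P2 : probability T2 R)
    (Z1 : {RV P1 >-> T'}) (Z2 : {RV P2 >-> T'}) : Prop :=
  forall B, measurable B -> distribution P1 Z1 B = distribution P2 Z2 B.

(* Main.v *)
(* The tail integral of a quantile function has the dual expression
   min_c ((1 - alpha) c + E (A - c)^+), whose minimizer satisfies
   eps |c| <= E A^+ when A is centered and alpha lies in [eps, 1 - eps].  Tail
   integrals of centered laws are thus controlled uniformly in alpha by
   H(c) = E (A - c)^+ on a compact interval of c.  For A = q'X the integrand is
   Lipschitz in (q, c) with a square-integrable constant, so that a finite net
   and Chebyshev's inequality give a law of large numbers that is uniform on the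
   sphere.  The same duality bounds the tail integrals below by eps E (q'X_0)^+,
   which is bounded away from 0 on the sphere because V(X) is non-singular, so
   the ratios and their infima S_eps converge uniformly in q; finally d_H is at
   most the supremum over q of the distance between the two values of S_eps. *)
From HB Require Import structures.
Require Import Defs.
From mathcomp Require Import all_boot all_order all_algebra finmap.
From mathcomp Require Import all_classical all_reals all_analysis.
From mathcomp Require Import measurable_realfun ring lra zify.
Import Order.TTheory GRing.Theory Num.Theory.
Import numFieldNormedType.Exports.
Set Implicit Arguments.
Unset Strict Implicit.
Unset Printing Implicit Defensive.
Local Open Scope classical_set_scope.
Local Open Scope ring_scope.

(** * Weak law of large numbers, uniform over a compact index set *)

(** The event that the distance exceeds [delta] involves suprema over the sphere, and its
    measurability is never addressed: bad events are only included in finite unions of measurable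
    ones, for which monotonicity and subadditivity of the outer measure are enough. Empirical laws
    are centered at sample means, so their excess functions are not averages of independent terms.
    As the positive part is 1-Lipschitz, the sample mean can be exchanged for the true mean at a
    cost that the law of large numbers for the mean itself controls; the true mean is then absorbed
    into a larger compact range of [c]. Quantile functions of nearby laws need not be close
    pointwise, while their excess functions are Lipschitz and are plain expectations; this is why
    the comparison goes through duality. The duality is proved for any integrable variable, hence
    holds for the population law and for the empirical law of a fixed outcome alike. [Y] is treated
    by the same statements as the projections of [X], as a family indexed by a single point. *)

Section weak_law.
Context {R : realType} {d : measure_display} {T : measurableType d}.
Variable P : probability T R.
Local Open Scope ereal_scope.

Definition rv d' (T' : measurableType d') (f : T -> T')
    (mf : measurable_fun setT f) : {RV P >-> T'} := mfun_Sub (mem_set mf).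

Lemma Rintegral_prob_cst (c : R) : (\int[P]_x c = c)%R.
Proof.
rewrite Rintegral_cst//; transitivity (c * fine (P setT))%R => //.
by rewrite probability_setT mulr1.
Qed.

Lemma Lfun2_Lfun1 (f : T -> R) : f \in Lfun P 2%:E -> f \in Lfun P 1.
Proof. by move=> f2; rewrite Lfun_subset12 ?fin_num_measure. Qed.

Lemma Lfun_measurable (p : \bar R) (f : T -> R) :
  f \in Lfun P p -> measurable_fun setT f.
Proof. by rewrite inE => /andP[]; rewrite inE. Qed.

Lemma Lfun2P (f : T -> R) : measurable_fun setT f ->
  P.-integrable setT (EFin \o (fun x => f x ^+ 2)%R) -> f \in Lfun P 2%:E.
Proof.
move=> mf /integrableP[_ foo]; rewrite inE; apply/andP; split; rewrite inE//=.
rewrite /finite_norm unlock /Lnorm; apply: poweR_lty.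
apply: le_lt_trans foo; rewrite le_eqVlt; apply/orP; left; apply/eqP.
apply: eq_integral => x _ /=.
by rewrite powR_mulrn// normrX.
Qed.

Lemma Lfun2D (f g : T -> R) : f \in Lfun P 2%:E -> g \in Lfun P 2%:E ->
  (fun x => f x + g x)%R \in Lfun P 2%:E.
Proof. by move=> f2 g2; rewrite -[X in X \in _]/(f \+ g)%R rpredD ?lee1n. Qed.

Lemma Lfun2_dominated (f g : T -> R) : measurable_fun setT f ->
  g \in Lfun P 2%:E -> (forall x, `|f x| <= `|g x|)%R -> f \in Lfun P 2%:E.
Proof.
move=> mf g2 fg; apply: Lfun2P => //.
apply: le_integrable (Lfun2_integrable_sqr g2) => //.
  by apply/measurable_EFinP; exact: measurable_funX.
by move=> x _ /=; rewrite lee_fin !normrX lerXn2r ?nnegrE.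
Qed.

Lemma variance_sum_uncorrelated (X : nat -> T -> R) (v : R) n :
  (forall i, X i \in Lfun P 2%:E) -> (forall i, 'V_P[X i] <= v%:E) ->
  (forall i j, i != j -> covariance P (X i) (X j) = 0) ->
  (fun w => \sum_(i < n) X i w)%R \in Lfun P 2%:E /\
  'V_P[(fun w => \sum_(i < n) X i w)%R] <= (n%:R * v)%:E.
Proof.
move=> X2 Xv X0.
have SS m : (fun w => \sum_(i < m.+1) X i w)%R =
    ((fun w => \sum_(i < m) X i w) \+ X m)%R.
  by apply/funext => w /=; rewrite big_ord_recr.
have S0 : (fun w => \sum_(i < 0) X i w)%R = cst 0%R.
  by apply/funext => w /=; rewrite big_ord0.
have S2 m : (fun w => \sum_(i < m) X i w)%R \in Lfun P 2%:E.
  elim: m => [|m IH]; first by rewrite S0 Lfun_cst.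
  by rewrite SS rpredD ?lee1n.
split=> //; elim: n => [|n IH].
  by rewrite S0 mul0r variance_cst.
have C0 m : (m <= n)%N ->
    covariance P (fun w => \sum_(i < m) X i w)%R (X n) = 0.
  elim: m => [|m IHm] mn.
    by rewrite S0 covariance_cst_l.
  by rewrite SS covarianceDl// IHm 1?ltnW// X0 ?adde0// neq_ltn mn.
rewrite SS varianceD// C0// mule0 adde0.
by rewrite -natr1 mulrDl mul1r EFinD leeD.
Qed.

(** Chebyshev's inequality for the average, whose variance is at most [v / n] because the
    covariances vanish. The explicit rate keeps the bound usable for each index of a family. *)
Lemma weak_law (X : nat -> T -> R) (m v delta : R) n :
  (0 < n)%N -> (0 < delta)%R ->
  (forall i, X i \in Lfun P 2%:E) -> (forall i, 'E_P[X i] = m%:E) ->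
  (forall i, 'V_P[X i] <= v%:E) ->
  (forall i j, i != j -> covariance P (X i) (X j) = 0) ->
  P [set w | (delta <= `|n%:R^-1 * \sum_(i < n) X i w - m|)%R] <=
    ((delta ^- 2 * v) / n%:R)%:E.
Proof.
move=> n0 d0 X2 Xm Xv X0.
have [S2 Sv] := variance_sum_uncorrelated n X2 Xv X0.
set S := (fun w => \sum_(i < n) X i w)%R in S2 Sv *.
have A2 : (n%:R^-1 \o* S)%R \in Lfun P 2%:E by rewrite Lfun_scale ?ler1n.
have ES : 'E_P[S] = (n%:R * m)%:E.
  rewrite unlock; under eq_integral do rewrite /S -sumEFin.
  rewrite integral_sum//; last first.
    by move=> i; apply/Lfun1_integrable; exact: Lfun2_Lfun1.
  transitivity (\sum_(i < n) m%:E).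
    by apply: eq_bigr => i _; rewrite -(Xm i) unlock.
  by rewrite sumEFin sumr_const card_ord mulr_natl.
have EA : 'E_P[(n%:R^-1 \o* S)%R] = m%:E.
  rewrite expectationZl ?Lfun2_Lfun1// ES -EFinM mulrA mulVf ?mul1r//.
  by rewrite pnatr_eq0 -lt0n.
have := chebyshev (rv (Lfun_measurable A2)) d0.
rewrite /= EA/= => H.
apply: le_trans (le_trans H _).
  rewrite le_eqVlt; apply/orP; left; apply/eqP; congr (P _).
  by apply/seteqP; split => w /=; rewrite mulrC.
have Vf := variance_fin_num S2.
rewrite varianceZ//; rewrite -(fineK Vf) in Sv *.
rewrite -!EFinM !lee_fin in Sv *; rewrite -mulrA.
rewrite ler_pM2l ?invr_gt0 ?exprn_gt0//.
have n1 : (0 < n%:R^-1 :> R)%R by rewrite invr_gt0 ltr0n.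
rewrite expr2 -mulrA (mulrC v) ler_pM2l// ler_pdivrMl ?ltr0n//.
Qed.

(** The joint law of [(U, V)] agrees with the product of the marginals on rectangles, hence
    everywhere; Fubini's theorem on the product then factors E(UV). *)
Lemma covariance_independent (U V : T -> R) :
  U \in Lfun P 2%:E -> V \in Lfun P 2%:E ->
  (forall A B, measurable A -> measurable B ->
    P (U @^-1` A `&` V @^-1` B) = P (U @^-1` A) * P (V @^-1` B)) ->
  covariance P U V = 0.
Proof.
move=> U2 V2 UV.
have mU := Lfun_measurable U2; have mV := Lfun_measurable V2.
have UV1 := Lfun2_mul_Lfun1 U2 V2.
have iU := Lfun2_Lfun1 U2; have iV := Lfun2_Lfun1 V2.
rewrite covarianceE// [in X in X - _]unlock.
pose dU := distribution P (rv mU); pose dV := distribution P (rv mV).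
have mW : measurable_fun setT (fun w =>
  (U w, V w)) by exact: measurable_fun_pair.
pose dW := distribution P (rv mW).
have dWE A : measurable A -> (dU \x dV) A = dW A.
  by apply: product_measure_unique => /= B C mB mC; rewrite -UV.
pose f := (fun z : R * R => (z.1 * z.2)%:E).
have mf : measurable_fun setT f.
  by apply/measurable_EFinP; apply: measurable_funM.
have ifW : dW.-integrable setT f.
  by apply: integrable_pushforward => //=; apply/Lfun1_integrable.
have if2 : (dU \x dV).-integrable setT f.
  apply/integrableP; split => //.
  rewrite (eq_measure_integral dW) => [|A mA _]; last exact: dWE.
  by have /integrableP[] := ifW.
rewrite (_ : \int[P]_w _ = \int[dW]_z f z); last first.
  by rewrite integral_distribution//=; apply/Lfun1_integrable.
rewrite -(eq_measure_integral dW (m1 := dU \x dV)) => [|A mA _];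
  last exact: dWE.
rewrite -integral12_prod_meas1//.
have iid (W : T -> R) (mf' : measurable_fun setT W) : W \in Lfun P 1 ->
    (distribution P (rv mf')).-integrable setT (EFin \o id).
  move=> /Lfun1_integrable iW; apply: integrable_pushforward => //=.
  by apply/measurable_EFinP.
have EV : \int[dV]_y y%:E = 'E_P[V].
  by rewrite unlock integral_distribution//=; apply/Lfun1_integrable.
have EU : \int[dU]_y y%:E = 'E_P[U].
  by rewrite unlock integral_distribution//=; apply/Lfun1_integrable.
rewrite (eq_integral (fun x => 'E_P[V] * x%:E)); last first.
  by move=> x _; rewrite /fubini_F /f /=; under eq_integral do rewrite EFinM;
   rewrite integralZl ?iid// EV muleC.
rewrite -(fineK (expectation_fin_num iV)) integralZl ?iid//.
by rewrite EU muleC subee// fin_numM ?expectation_fin_num.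
Qed.

End weak_law.

(** * Sequences of sets whose outer probability tends to 0 *)

Section outer_convergence.
Context {R : realType} {d : measure_display} {T : measurableType d}.
Variable P : probability T R.
Local Open Scope ereal_scope.

Definition outer_null (A : nat -> set T) :=
  (P^*)%mu (A n) @[n --> \oo] --> (0 : \bar R).

Lemma outer_null_sub (A B : nat -> set T) :
  (\forall n \near \oo, A n `<=` B n) -> outer_null B -> outer_null A.
Proof.
move=> AB B0; apply: squeeze_cvge (cvg_cst 0) B0.
near=> n; rewrite mu_ext_ge0 ?measure_ge0//=; apply: le_mu_ext.
by near: n.
Unshelve. all: by end_near. Qed.

Lemma outer_nullU (A B : nat -> set T) :
  outer_null A -> outer_null B -> outer_null (fun n => A n `|` B n).
Proof.
move=> A0 B0.
apply: (@squeeze_cvge _ _ _ _ (cst 0) _ (fun n =>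
  (P^*)%mu (A n) + (P^*)%mu (B n))).
- near=> n; rewrite mu_ext_ge0 ?measure_ge0//=; exact: outer_measureU2.
- exact: cvg_cst.
- by rewrite -[X in _ --> X]adde0; apply: cvgeD.
Unshelve. all: by end_near. Qed.

Lemma outer_null_bigsetU (I : eqType) (s : seq I) (A : I -> nat -> set T) :
  (forall i, i \in s -> outer_null (A i)) ->
  outer_null (fun n => \big[setU/set0]_(i <- s) A i n).
Proof.
elim: s => [|i s IH] A0.
  rewrite /outer_null (_ : (fun n => _) = cst 0); first exact: cvg_cst.
  by apply/funext => n; rewrite big_nil mu_ext0.
rewrite (_ : (fun n => _) = fun n => A i n `|` \big[setU/set0]_(j <- s) A j n).
2: by apply/funext => n; rewrite big_cons.
apply: outer_nullU; first by apply: A0; rewrite mem_head.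
by apply: IH => j js; apply: A0; rewrite inE js orbT.
Qed.

Lemma outer_null_comp (A : nat -> set T) (f : nat -> nat) :
  f k @[k --> \oo] --> \oo -> outer_null A -> outer_null (A \o f).
Proof. by move=> fy A0; apply: cvg_comp fy A0. Qed.

(** The bound is asked for [0 < n] only, since [C / 0] is 0 by convention. *)
Lemma outer_null_bound (A : nat -> set T) (C : R) :
  (forall n, measurable (A n)) ->
  (forall n, (0 < n)%N -> P (A n) <= (C / n%:R)%:E) -> outer_null A.
Proof.
move=> mA PA; rewrite /outer_null.
under eq_fun do rewrite measurable_mu_extE//.
apply: (@squeeze_cvge _ _ _ _ (cst 0) _ (fun n => (C / n%:R)%:E)).
- near=> n; rewrite measure_ge0/=; apply: PA; near: n; exact: nbhs_infty_gt.
- exact: cvg_cst.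
- apply: cvg_EFin; first by near=> n.
  rewrite -[X in _ --> X](mulr0 C); apply: cvgMr.
  apply/gtr0_cvgV0; first by near=> n; rewrite ltr0n; near: n;
    exact: nbhs_infty_gt.
  exact: cvgr_idn.
Unshelve. all: by end_near. Qed.

End outer_convergence.

Lemma compact_ball_cover (R : realType) (V : pseudoMetricType R) (K : set V)
    (r : R) : compact K -> 0 < r ->
  exists D : seq V, forall v, K v -> exists2 u, u \in D & ball u r v.
Proof.
move=> cK r0; have [->|/set0P[v0 _]] := eqVneq K set0; first by exists [::].
(* A point of the nonempty space provides the pointed structure over which [compact_cover] is
   stated. *)
pose V' : ptopologicalType := HB.pack (V : Type) (Topological.class V)
  (isPointed.Build V v0).
have : @compact V' K by exact: cK.
rewrite compact_cover => /(_ V K (fun v => (ball v r)^°)).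
case.
- by move=> v _; exact: open_interior.
- by move=> v Kv; exists v => //; exact: nbhsx_ballx.
move=> D _ KD; exists D => v /KD[u Du vu]; exists u => //.
exact: interior_subset vu.
Qed.

(** * Laws of large numbers for samples of independent, identically distributed elements *)

Section sample.
Context {R : realType} {d d' dE : measure_display} {T : measurableType d}
  {Om : measurableType d'} {E : measurableType dE}.
Variables (P : probability T R) (Q : probability Om R).
Variables (Z : {RV P >-> E}) (Zs : nat -> {RV Q >-> E}).
Hypothesis law : forall i, same_law (Zs i) Z.
Hypothesis indep : mutually_independent Q Zs.
Local Open Scope ereal_scope.

Lemma pairwise_independent i j A B : i != j -> measurable A -> measurable B ->
  Q (Zs i @^-1` A `&` Zs j @^-1` B) = Q (Zs i @^-1` A) * Q (Zs j @^-1` B).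
Proof.
move=> ij mA mB.
have /= := indep [fset i; j]%fset (B := fun k => if k == i then A else B).
have iNj : i \notin [fset j]%fset by rewrite inE.
rewrite big_fsetU1//= big_seq_fset1 eqxx eq_sym (negbTE ij) => <-; last first.
  by move=> k; case: ifP.
congr (Q _); apply/seteqP; split => w.
  move=> [Aw Bw] k /=; rewrite !inE => /orP[]/eqP ->; first by rewrite eqxx.
  by rewrite eq_sym (negbTE ij).
move=> H; split.
  by have := H i; rewrite /= !inE eqxx => /(_ isT).
by have := H j; rewrite /= !inE eqxx orbT eq_sym (negbTE ij) => /(_ isT).
Qed.

Lemma sample_integral_ge0 (g : E -> \bar R) i : measurable_fun setT g ->
  (forall x, 0 <= g x) -> \int[Q]_w g (Zs i w) = \int[P]_w g (Z w).
Proof.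
move=> mg g0; rewrite -[LHS](ge0_integral_distribution (Zs i))//.
rewrite -[RHS](ge0_integral_distribution Z)//.
by apply: eq_measure_integral => A mA _; exact: law.
Qed.

Lemma sample_integrable (g : E -> \bar R) i : measurable_fun setT g ->
  P.-integrable setT (g \o Z) -> Q.-integrable setT (g \o Zs i).
Proof.
move=> mg /integrableP[_ goo]; apply/integrableP; split.
  exact: measurableT_comp.
rewrite (sample_integral_ge0 (g := fun z => `|g z|))//.
exact: measurableT_comp.
Qed.

Lemma sample_integral (g : E -> \bar R) i : measurable_fun setT g ->
  P.-integrable setT (g \o Z) -> \int[Q]_w g (Zs i w) = \int[P]_w g (Z w).
Proof.
move=> mg ig; rewrite -[LHS](@integral_distribution _ _ _ _ _ _ (Zs i))//;
  last first.
  exact: sample_integrable.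
rewrite -[RHS](@integral_distribution _ _ _ _ _ _ Z)//.
by apply: eq_measure_integral => A mA _; exact: law.
Qed.

Lemma sample_Lfun2 (f : E -> R) i : measurable_fun setT f ->
  f \o Z \in Lfun P 2%:E -> f \o Zs i \in Lfun Q 2%:E.
Proof.
move=> mf f2; apply: Lfun2P; first exact: measurableT_comp.
apply: (sample_integrable (g := fun z => (f z ^+ 2)%:E)).
  by apply/measurable_EFinP; exact: measurable_funX.
exact: Lfun2_integrable_sqr f2.
Qed.

Lemma sample_weak_law (f : E -> R) (delta : R) : measurable_fun setT f ->
  f \o Z \in Lfun P 2%:E -> (0 < delta)%R ->
  outer_null Q (fun n => [set w |
    (delta <= `|n%:R^-1 * \sum_(i < n) f (Zs i w) - \int[P]_x f (Z x)|)%R]).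
Proof.
move=> mf f2 d0; set m := (\int[P]_x f (Z x))%R.
have mfs i : measurable_fun setT (f \o Zs i) by exact: measurableT_comp.
have iZ : P.-integrable setT (EFin \o (f \o Z)).
  by apply/Lfun1_integrable; exact: Lfun2_Lfun1.
have mE : measurable_fun setT (EFin \o f) by apply/measurable_EFinP.
have Es i : 'E_Q[f \o Zs i] = m%:E.
  rewrite unlock (sample_integral (g := EFin \o f))// /m /Rintegral.
  by rewrite fineK//; exact: integrable_fin_num.
(* Both variances are integrals against the law of [Z], so the one at index 0 serves as common
   bound. *)
have Vs i : 'V_Q[f \o Zs i] <= (fine 'V_Q[f \o Zs 0%N])%:E.
  rewrite fineK; last by apply: variance_fin_num; exact: sample_Lfun2.
  rewrite /variance !(covariance.unlock) !Es/= unlock.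
  pose g := (fun z => ((f z - m) * (f z - m))%:E).
  rewrite (sample_integral_ge0 (g := g)).
  - rewrite -(sample_integral_ge0 (g := g) 0%N)//.
      by apply/measurable_EFinP; apply: measurable_funM; exact: measurable_funB.
    by move=> x; rewrite lee_fin -expr2 sqr_ge0.
  - by apply/measurable_EFinP; apply: measurable_funM; exact: measurable_funB.
  - by move=> x; rewrite lee_fin -expr2 sqr_ge0.
apply: (outer_null_bound (C := (delta ^- 2 * fine 'V_Q[f \o Zs 0%N])%R)).
  move=> n; rewrite -[X in measurable X]setTI.
  apply: (measurable_fun_le (f := cst delta)) => //.
  apply: measurableT_comp => //; apply: measurable_funB => //.
  by apply: measurable_funM => //; apply: measurable_sum => i; exact: mfs.
move=> n n0; apply: (weak_law (X := fun i => f \o Zs i)) => //.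
- by move=> i; exact: sample_Lfun2.
- move=> i j ij; apply: covariance_independent.
  + exact: sample_Lfun2.
  + exact: sample_Lfun2.
  + move=> A B mA mB.
    apply: (pairwise_independent (A := f @^-1` A) (B := f @^-1` B)) => //.
    * by rewrite -[X in measurable X]setTI; exact: mf.
    * by rewrite -[X in measurable X]setTI; exact: mf.
Qed.

(* A finite net of the index set reduces the supremum to finitely many
   weak laws, plus the one for the Lipschitz constant [l]. *)
Lemma uniform_weak_law (V : pseudoMetricType R) (K : set V) (g : V -> E -> R)
    (l : E -> R) (eta : R) :
  compact K -> (forall v, measurable_fun setT (g v)) -> measurable_fun setT l ->
  (forall v, g v \o Z \in Lfun P 2%:E) -> l \o Z \in Lfun P 2%:E ->
  (forall v v' r z, ball v r v' -> `|g v z - g v' z| <= l z * r)%R ->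
  (0 < eta)%R ->
  outer_null Q (fun n => [set w | exists2 v, K v &
    (eta < `|n%:R^-1 * \sum_(i < n) g v (Zs i w) - \int[P]_x g v (Z x)|)%R]).
Proof.
move=> cK mg ml g2 l2 lip eta0.
set L := (\int[P]_x l (Z x))%R.
(* Outside [badl] the sample average of [l] is below [L + 1]. With this radius, replacing [v] by a
   net point thus moves the sample average and the expectation by at most [eta / 3] each; the last
   third is the error at the net point. *)
pose r := (eta / 3 / (`|L| + 1))%R.
have L1 : (0 < `|L| + 1)%R by rewrite ltr_wpDl.
have r0 : (0 < r)%R by rewrite !divr_gt0.
have rL (s : R) : (s <= `|L| + 1)%R -> (s * r <= eta / 3)%R.
  by move=> sL; rewrite /r mulrA ler_pdivrMr// mulrC ler_pM2l// divr_gt0.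
have [D KD] := compact_ball_cover cK r0.
pose bad v n := [set w |
  (eta / 3 <= `|n%:R^-1 * \sum_(i < n) g v (Zs i w) - \int[P]_x g v (Z x)|)%R].
pose badl n := [set w |
  (1 <= `|n%:R^-1 * \sum_(i < n) l (Zs i w) - L|)%R].
apply: (@outer_null_sub _ _ _ _ _
    (fun n => (\big[setU/set0]_(v <- D) bad v n) `|` badl n)); last first.
  apply: outer_nullU; last exact: sample_weak_law.
  apply: outer_null_bigsetU => v _; apply: sample_weak_law => //.
  by rewrite divr_gt0.
near=> n => w /= [v Kv].
apply: contraPP => /not_orP[]; rewrite -bigcup_seq => nbad.
rewrite /badl/= => /negP; rewrite -ltNge => lw; apply/negP; rewrite -leNgt.
have n0 : (0 < n)%N by near: n; exact: nbhs_infty_gt.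
have nR : (0 < n%:R^-1 :> R)%R by rewrite invr_gt0 ltr0n.
have [u Du vu] := KD _ Kv.
have : ~ bad u n w by move=> bu; apply: nbad; exists u.
rewrite /bad/= => /negP; rewrite -ltNge => bu.
have i1 v1 : P.-integrable setT (EFin \o (fun x => g v1 (Z x))).
  by apply/Lfun1_integrable/Lfun2_Lfun1; exact: g2.
have il : P.-integrable setT (EFin \o (fun x => l (Z x))).
  by apply/Lfun1_integrable/Lfun2_Lfun1.
have iB : P.-integrable setT (EFin \o (fun x => g u (Z x) - g v (Z x))%R).
  exact: (integrableB measurableT (i1 u) (i1 v)).
have e1 : (`|\int[P]_x g u (Z x) - \int[P]_x g v (Z x)| <= eta / 3)%R.
  rewrite -RintegralB//; apply: le_trans (le_normr_Rintegral _ _) _ => //.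
  apply: (@le_trans _ _ (\int[P]_x (l (Z x) * r))%R).
    apply: le_Rintegral => //.
    - by apply: (integrable_norm iB).
    - exact: (integrableZr measurableT r il).
    - by move=> x _; exact: lip.
  by rewrite RintegralZr// rL// ler_wpDr// ler_norm.
have e2 : (`|n%:R^-1 * \sum_(i < n) g u (Zs i w) -
             n%:R^-1 * \sum_(i < n) g v (Zs i w)| <= eta / 3)%R.
  rewrite -mulrBr normrM gtr0_norm// -sumrB.
  apply: (@le_trans _ _ (n%:R^-1 * \sum_(i < n) (l (Zs i w) * r))%R).
    rewrite ler_pM2l//; apply: le_trans (ler_norm_sum _ _ _) _.
    by apply: ler_sum => i _; exact: lip.
  rewrite -mulr_suml mulrA rL//.
  by have := ler_norm L; move: lw; rewrite ltr_norml => /andP[]; lra.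
move: bu e1 e2; rewrite ltr_norml !ler_norml.
move=> /andP[? ?] /andP[? ?] /andP[? ?]; apply/andP; split; lra.
Unshelve. all: by end_near. Qed.

End sample.

(** * Dual expression of the tail integral *)

Lemma measurable_excess (R : realType) d (S : measurableType d) (D : set S)
    (f : S -> R) c :
  measurable_fun D f -> measurable_fun D (fun t => Num.max (f t - c) 0).
Proof.
by move=> mf; apply: measurable_maxr => //; exact: measurable_funB.
Qed.

Section tail_duality.
Context {R : realType} {d : measure_display} {T : measurableType d}.
Variable P : probability T R.
Variable A : {RV P >-> R}.
Hypothesis iA : P.-integrable setT (EFin \o A).
Local Notation mu := (@lebesgue_measure R).
Local Notation mR := (measurableTypeR R).
Local Notation F := (cdfR A).
Local Notation Q := (quantile F).

Lemma cdfRE t : (F t)%:E = cdf A t.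
Proof. by rewrite /cdfR fineK// fin_num_measure. Qed.

Lemma cdfR_nondecreasing s t : s <= t -> F s <= F t.
Proof. by move=> st; rewrite -lee_fin !cdfRE cdf_nondecreasing. Qed.

Lemma cdfR_ge0 t : 0 <= F t.
Proof. by rewrite -lee_fin cdfRE cdf_ge0. Qed.

Lemma cdfR_le1 t : F t <= 1.
Proof. by rewrite -lee_fin cdfRE cdf_le1. Qed.

(** Galois connection between quantile and cdf. For [0 < t < 1] the limits of the cdf at both
    infinities make the defining set nonempty and bounded below, so that [inf] is a true infimum;
    right continuity shows that the infimum is attained. *)
Lemma quantile_le t x : 0 < t < 1 -> (Q t <= x) = (t <= F x).
Proof.
move=> /andP[t0 t1].
have [y ty] : exists y, t <= F y.
  have /fine_cvg/cvgr_gt/(_ _ t1) := cvg_cdfy1 A.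
  move=> /pinfty_ex_gt0[y y0] ty; exists y; exact: ltW.
have [z zt] : exists z, F z < t.
  have /fine_cvg/cvgr_lt/(_ _ t0) := cvg_cdfNy0 A.
  by move=> [M [Mr H]]; exists (M - 1); apply: H; rewrite ltrBlDr ltrDl.
have zlb u : F u < t -> lbound [set x | t <= F x] u.
  move=> ut v /= tv; rewrite leNgt; apply/negP => vu.
  by have := le_lt_trans (le_trans tv (cdfR_nondecreasing (ltW vu))) ut;
    rewrite ltxx.
apply/idP/idP => [Qx|tx]; last first.
  by apply: ge_inf => //; exists z; exact: zlb.
rewrite leNgt; apply/negP => xt.
have : F @ x^'+ --> F x.
  apply: fine_cvg; rewrite cdfRE; exact: cdf_right_continuous.
move=> /cvgr_lt/(_ _ xt) near_t.
have [u xu ut] : exists2 u, x < u & F u < t.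
  have : \forall u \near x^'+, x < u /\ F u < t.
    by near=> u; split; near: u => //; exact: nbhs_right_gt.
  by move=> /filter_ex[u [xu ut]]; exists u.
have : u <= Q t by apply: lb_le_inf; [exists y|exact: zlb].
by move=> /le_trans/(_ Qx); rewrite leNgt xu.
Unshelve. all: by end_near. Qed.

Lemma quantile_gt t x : 0 < t < 1 -> (x < Q t) = (F x < t).
Proof. by move=> t01; rewrite !ltNge quantile_le. Qed.

Lemma quantile_nondecreasing s t : 0 < s -> t < 1 -> s <= t -> Q s <= Q t.
Proof.
move=> s0 t1 st; rewrite quantile_le ?s0 ?(le_lt_trans st)//.
have t01 : 0 < t < 1 by rewrite t1 (lt_le_trans s0 st).
by rewrite (le_trans st)// -quantile_le.
Qed.

Lemma measurable_quantile : measurable_fun (`]0, 1[ : set R) Q.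
Proof.
move=> mD; move: (mD).
apply: (measurability (@RGenCInfty.G R)) => [|/= _ [_] [r] -> <-].
  exact: RGenCInfty.measurableE.
apply: is_interval_measurable => s t /=.
rewrite /= !in_itv/= !andbT =>
  -[/andP[s0 s1] Qs] [/andP[t0 t1] Qt] u /andP[su ut].
have u1 := le_lt_trans ut t1.
rewrite !in_itv/= (lt_le_trans s0 su) u1; split; rewrite // andbT.
by rewrite (le_trans Qs)// quantile_nondecreasing.
Qed.

(** At 0, at 1 and outside the unit interval [quantile] can be a default value of [inf]. The
    restriction provides a function that is measurable on the whole line, hence a random variable
    for the uniform law [U]. *)
Let Q0 : R -> R := Q \_ `]0, 1[.

Let mQ0 : @measurable_fun _ _ mR R setT Q0.
Proof. by apply/(measurable_restrictT _ _).1 => //;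
  exact: measurable_quantile. Qed.

Let Q0E t : 0 < t < 1 -> Q0 t = Q t.
Proof. by move=> t01; rewrite /Q0 patchE ifT// inE /= in_itv. Qed.

Let U := uniform_prob (@ltr01 R).

(** Nothing is known of [B] at 0, at 1 or beyond, so its trace on [0, 1] is squeezed between ]a, 1[
    and the union of {0} and [a, 1], which have the same measure. *)
Let uniformE (B : set R) (a : R) : measurable B -> 0 <= a <= 1 ->
  (forall t, 0 < t < 1 -> B t <-> a < t) -> U B = (1 - a)%:E.
Proof.
move=> mB /andP[a0 a1] Ba.
have -> : U B = mu (B `&` `[0, 1]).
  rewrite /U /uniform_prob integral_uniform_pdf.
  rewrite (eq_integral (cst 1%E)) ?integral_cst ?mul1e//.
    exact: measurableI.
  move=> x; rewrite inE => -[_]; rewrite /= in_itv/= => x01.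
  by rewrite /uniform_pdf x01 subr0 invr1.
have mBI : measurable (B `&` `[0, 1]) by exact: measurableI.
apply/eqP; rewrite eq_le; apply/andP; split.
  apply: (@le_trans _ _ (mu ([set 0%R] `|` `[a, 1]))).
    apply: le_measure; rewrite ?inE//; first exact: measurableU.
    move=> x [Bx]; rewrite /= in_itv/= => /andP[x0 x1].
    have [->|xn0] := eqVneq x 0; first by left.
    have xp : 0 < x by rewrite lt_neqAle eq_sym xn0.
    right; rewrite /= in_itv/= x1 andbT; have [->//|xn1] := eqVneq x 1.
    by apply/ltW/Ba => //; rewrite xp lt_neqAle xn1.
  apply: (@le_trans _ _ (mu [set 0%R] + mu (`[a, 1%R]%classic))%E).
    exact: measureU2.
  rewrite lebesgue_measure_set1 add0e lebesgue_measure_itv/= lte_fin.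
  by case: ifP => // _; rewrite lee_fin subr_ge0.
apply: (@le_trans _ _ (mu `]a, 1[)).
  rewrite lebesgue_measure_itv/= lte_fin; case: ifP => [_|/negbT].
    by rewrite lee_fin.
  by rewrite -leNgt lee_fin subr_le0.
apply: le_measure; rewrite ?inE// => x; rewrite /= in_itv/= => /andP[ax x1].
have x0 := le_lt_trans a0 ax.
by split; [apply/Ba; rewrite ?x0|rewrite in_itv/= !ltW].
Qed.

(** Inverse transform: the quantile function of a uniform variable has the law of [A]. Both
    expectations are layer-cake integrals of tail probabilities, and [quantile_gt] turns the uniform
    measure of a tail event into [1 - F (c + r)]. *)
Lemma integral_quantile_excess c :
  (\int[mu]_(t in `]0%R, 1%R[) (Num.max (Q t - c) 0)%:E =
   \int[P]_w (Num.max (A w - c) 0)%:E)%E.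
Proof.
have mUc : @measurable_fun _ _ mR R setT (fun t => Num.max (Q0 t - c) 0).
  exact: measurable_excess mQ0.
have mAc : measurable_fun setT (fun w => Num.max (A w - c) 0).
  exact: measurable_excess.
have EA := @ge0_expectation_ccdf _ _ _ P (rv _ mAc).
have EU := @ge0_expectation_ccdf _ _ _ U (rv _ mUc).
have mx0 (x : R) : 0 <= Num.max x 0 by rewrite le_max lexx orbT.
have : ('E_U[rv U mUc] = 'E_P[rv P mAc])%E.
  rewrite EA ?EU//; last 2 first.
  - by move=> x; exact: mx0.
  - by move=> x; exact: mx0.
  apply: eq_integral => r; rewrite inE/= in_itv/= andbT => r0.
  have gt0 (x : R) : (r < Num.max (x - c) 0) = (c + r < x).
    by rewrite lt_max ltrBrDl (ltNge r 0) r0 orbF.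
  rewrite [RHS](_ : _ = ccdf A (c + r)); last first.
    rewrite /ccdf /distribution /pushforward; congr (P _).
    by apply/seteqP; split => w /=; rewrite !in_itv/= !andbT gt0.
  rewrite ccdf_1_cdf -cdfRE -EFinB; apply: uniformE.
  - rewrite -[X in measurable X]setTI; refine (mUc measurableT _ _).
    exact: measurable_itv.
  - by rewrite cdfR_ge0 cdfR_le1.
  - by move=> t t01 /=; rewrite in_itv/= andbT gt0 Q0E// quantile_gt.
rewrite unlock/= integral_uniform//; last 2 first.
- exact/measurable_EFinP.
- by move=> x; rewrite lee_fin.
rewrite subr0 invr1 mul1e => <-.
have mm D : measurable_fun D (fun t => (Num.max (Q0 t - c) 0)%:E).
  by apply/measurable_EFinP; apply: measurable_funTS.
rewrite -integral_itv_bndo_bndc// -integral_itv_obnd_cbnd//.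
by apply: eq_integral => t; rewrite inE/= in_itv/= => t01; rewrite Q0E.
Qed.

(** This is the stop-loss transform of the law of [A]. *)
Definition excess c : R := \int[P]_w Num.max (A w - c) 0.

Lemma integrable_excess c :
  P.-integrable setT (EFin \o (fun w => Num.max (A w - c) 0)).
Proof.
apply: (@le_integrable _ _ _ P _ measurableT _ (EFin \o (fun w =>
  `|A w| + `|c|))).
- apply/measurable_EFinP; exact: measurable_excess.
- move=> w _ /=; rewrite lee_fin [X in _ <= X]ger0_norm ?addr_ge0//.
  rewrite ger0_norm ?le_max ?lexx ?orbT// ge_max addr_ge0// andbT.
  by rewrite (le_trans (ler_norm _))// ler_normB.
- exact: (integrableD measurableT (integrable_norm iA)
    (finite_measure_integrable_cst P `|c| measurableT)).
Qed.

Lemma EFin_excess c : (excess c)%:E = (\int[P]_w (Num.max (A w - c) 0)%:E)%E.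
Proof. by rewrite /excess /Rintegral fineK//;
  exact: integrable_fin_num (integrable_excess c). Qed.

Variable alpha : R.
Hypothesis alpha01 : 0 < alpha < 1.

(** The point 1 is left out: if the law is unbounded above, no [x] satisfies [1 <= F x] and the
    quantile at 1 is a default value. The integral is the same, as a point is Lebesgue null. *)
Let D : set mR := `[alpha, 1[.

Let mD : measurable D. Proof. exact: measurable_itv. Qed.

Let DE t : D t -> 0 < t < 1.
Proof.
rewrite /D/= in_itv/= => /andP[at1 ->]; rewrite andbT.
by case/andP: alpha01 => a0 _; exact: lt_le_trans at1.
Qed.

Let mQD : measurable_fun D Q.
Proof. by apply: measurable_funS measurable_quantile => // t /DE;
  rewrite /= in_itv. Qed.

Let int_excess_le c : (\int[mu]_(t in D) (Num.max (Q t - c) 0)%:E <= (excess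
  c)%:E)%E.
Proof.
rewrite EFin_excess -integral_quantile_excess; apply: ge0_subset_integral => //.
- apply/measurable_EFinP; apply: measurable_excess; exact: measurable_quantile.
- by move=> t _; rewrite lee_fin le_max lexx orbT.
Qed.

Let mExc c : measurable_fun D (fun t => Num.max (Q t - c) 0).
Proof. exact: measurable_excess. Qed.

Let iExc c : mu.-integrable D (EFin \o (fun t => Num.max (Q t - c) 0)).
Proof.
apply/integrableP; split; first exact/measurable_EFinP.
apply: le_lt_trans (le_trans _ (int_excess_le c)) (ltry _).
rewrite le_eqVlt; apply/orP; left; apply/eqP; apply: eq_integral => t _ /=.
by rewrite ger0_norm// le_max lexx orbT.
Qed.

Let muD : mu D = (1 - alpha)%:E.
Proof.
by rewrite /D lebesgue_measure_itv/= lte_fin; case/andP: alpha01 => _ ->.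
Qed.

Let icst c : (mu : {measure set mR -> \bar R}).-integrable D (EFin \o cst c).
Proof.
apply/integrableP; split; first exact/measurable_EFinP.
by rewrite (eq_integral (cst `|c|%:E))// integral_cst//;
  rewrite (_ : _ D = (1 - alpha)%:E)// -EFinM ltry.
Qed.

Let iQ : mu.-integrable D (EFin \o Q).
Proof.
apply: (@le_integrable _ _ _ mu _ mD _
  (EFin \o (fun t => Num.max (Q t - Q alpha) 0 + `|Q alpha|))).
- exact/measurable_EFinP.
- move=> t Dt /=; rewrite lee_fin.
  have Qt : 0 <= Q t - Q alpha.
    rewrite subr_ge0; case/andP: alpha01 => a0 _; move: (Dt);
      rewrite /D/= in_itv/= => /andP[at1 t1].
    exact: quantile_nondecreasing.
  rewrite (max_idPl Qt).
  rewrite [X in _ <= X]ger0_norm; last exact: addr_ge0 Qt (normr_ge0 _).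
  by rewrite -{1}(subrK (Q alpha) (Q t)) (le_trans (ler_normD _ _))// ger0_norm.
- exact: (integrableD mD (iExc _) (icst _)).
Qed.

Let tailE : tail_integral alpha F = \int[mu]_(t in D) Q t.
Proof.
rewrite /tail_integral /Rintegral /D integral_itv_bndo_bndc//.
exact/measurable_EFinP.
Qed.

Let tail_shift c :
  tail_integral alpha F = (1 - alpha) * c + \int[mu]_(t in D) (Q t - c).
Proof.
rewrite tailE RintegralB//; last exact: icst.
rewrite (_ : \int[mu]_(_ in D) c = (1 - alpha) * c).
  by rewrite addrCA subrr addr0.
rewrite Rintegral_cst// mulrC; congr (_ * _).
by rewrite -[RHS]/(fine (1 - alpha)%:E) -muD.
Qed.

(** Weak duality: on [D] the shifted quantile [Q t - c] is at most its positive part, whose integral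
    only grows when the range is extended to ]0, 1[. *)
Lemma tail_integral_le c :
  tail_integral alpha F <= (1 - alpha) * c + excess c.
Proof.
rewrite (tail_shift c) lerD2l.
apply: (@le_trans _ _ (\int[mu]_(t in D) Num.max (Q t - c) 0)).
  apply: le_Rintegral => //.
  - exact: (integrableB mD iQ (icst c)).
  - by move=> t _; rewrite le_max lexx.
rewrite -lee_fin /Rintegral fineK; first exact: int_excess_le.
by apply: integrable_fin_num => //; exact: iExc.
Qed.

(** At [c = Q alpha] both inequalities of weak duality are equalities: by monotonicity [Q t - c] is
    nonnegative above [alpha] and nonpositive below. *)
Lemma tail_integral_eq :
  tail_integral alpha F = (1 - alpha) * Q alpha + excess (Q alpha).
Proof.
set c := Q alpha; rewrite (tail_shift c); congr (_ + _).
rewrite /Rintegral /excess /Rintegral -integral_quantile_excess; congr fine.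
rewrite [LHS]integral_mkcond [RHS]integral_mkcond; apply: eq_integral => t _.
case/andP: (alpha01) => a0 a1.
rewrite !patchE /D !mem_setE !in_itv/=; have [at1|ta] := leP alpha t.
  rewrite (lt_le_trans a0 at1)/=; case: ifP => // t1.
  rewrite max_l// subr_ge0; exact: quantile_nondecreasing.
rewrite /=; case: ifP => // /andP[t0 t1].
rewrite max_r// subr_le0; apply: quantile_nondecreasing => //; exact: ltW.
Qed.

End tail_duality.

(** * The empirical distribution as a probability law *)

Section empirical_law.
Context {R : realType}.
Variables (n : nat) (a : nat -> R).

(** The successor excludes the empty sample, so that the total mass is 1 and the duality for random
    variables applies to the identity under this law. *)
Definition emp_law : set R -> \bar R :=
  mscale ((n.+1%:R : R)^-1)%:nng (msum (fun i => \d_(a i)) n.+1).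

Lemma emp_lawE A : emp_law A =
  ((n.+1%:R^-1)%:E * \sum_(i < n.+1) ((a i \in A)%:R)%:E)%E.
Proof. by congr (_ * _)%E; apply: eq_bigr => i _; rewrite diracE. Qed.

HB.instance Definition _ := Measure.on emp_law.

Let emp_lawT : emp_law setT = 1%E.
Proof.
rewrite /emp_law /mscale/= /msum/=.
under eq_bigr do rewrite diracT.
by rewrite sumEFin sumr_const card_ord -EFinM mulVf.
Qed.

HB.instance Definition _ :=
  Measure_isProbability.Build _ _ _ emp_law emp_lawT.

Definition emp_rv : {RV emp_law >-> R} := rv emp_law (@measurable_id _ _ setT).

Lemma cdfR_emp : cdfR emp_rv = ecdf n.+1 a.
Proof.
apply/funext => t; rewrite /cdfR.
rewrite (_ : cdf emp_rv t =
    ((n.+1%:R^-1)%:E * \sum_(i < n.+1) ((a i <= t)%R%:R)%:E)%E).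
  by rewrite sumEFin.
apply: etrans (emp_lawE _) _; congr (_ * _)%E; apply: eq_bigr => i _.
rewrite (_ : (a i \in _) = (a i <= t))//.
by apply/idP/idP; rewrite inE/= in_itv/=.
Qed.

Lemma integral_emp_ge0 (f : R -> R) : measurable_fun setT f ->
  (forall x, 0 <= f x) ->
  (\int[emp_law]_x (f x)%:E = (n.+1%:R^-1 * \sum_(i < n.+1) f (a i))%:E)%E.
Proof.
move=> mf f0; have mE : measurable_fun setT (EFin \o f) by
  apply/measurable_EFinP.
rewrite ge0_integral_mscale//; last by move=> x _; rewrite lee_fin.
rewrite ge0_integral_measure_sum//; last by move=> x _; rewrite lee_fin.
under eq_bigr do rewrite integral_dirac// diracT mul1e.
by rewrite sumEFin.
Qed.

Lemma integrable_emp : emp_law.-integrable setT (EFin \o emp_rv).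
Proof.
apply/integrableP; split; first exact/measurable_EFinP.
by rewrite integral_emp_ge0// ltry.
Qed.

Lemma excess_emp c : excess emp_rv c =
  n.+1%:R^-1 * \sum_(i < n.+1) Num.max (a i - c) 0.
Proof.
rewrite /excess /Rintegral (integral_emp_ge0 (f := fun x =>
  Num.max (x - c) 0))//.
- exact: measurable_excess.
- by move=> x; rewrite le_max lexx orbT.
Qed.

End empirical_law.

(** * From tail integrals to the Hausdorff distance *)

Section tail_dual.
Context {R : realType}.

(* [H c] plays the role of E (A - c)^+, with A centered and of cdf [F]. *)
Record tail_dual (F H : R -> R) : Prop := TailDual {
  dual_ge0 : forall c, 0 <= H c;
  dual_geN : forall c, - c <= H c;
  dual_anti : forall c c', c <= c' -> H c' <= H c;
  dual_lip : forall c c', c <= c' -> H c <= H c' + (c' - c);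
  dual_le : forall alpha c, 0 < alpha < 1 ->
    tail_integral alpha F <= (1 - alpha) * c + H c;
  dual_eq : forall alpha, 0 < alpha < 1 ->
    exists c, tail_integral alpha F = (1 - alpha) * c + H c }.

Lemma tail_dual_excess d (T : measurableType d) (P : probability T R)
    (A : {RV P >-> R}) :
  P.-integrable setT (EFin \o A) -> (forall c, - c <= excess A c) ->
  tail_dual (cdfR A) (excess A).
Proof.
move=> iA geN; split=> //.
- by move=> c; apply: Rintegral_ge0 => w _; rewrite le_max lexx orbT.
- move=> c c' cc'; apply: le_Rintegral => //; try exact: integrable_excess.
  by move=> w _; rewrite ge_max !le_max lexx orbT andbT lerB.
- move=> c c' cc'.
  have ic : P.-integrable setT (EFin \o cst (c' - c)).
    exact: finite_measure_integrable_cst.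
  rewrite -(Rintegral_prob_cst P (c' - c)) -RintegralD//;
    last exact: integrable_excess.
  apply: le_Rintegral => //; first exact: integrable_excess.
    exact: (integrableD measurableT (integrable_excess iA c') ic).
  move=> w _; rewrite ge_max; apply/andP; split.
    rewrite -[leLHS](subrK (c' - c)) lerD2r le_max; apply/orP; left; lra.
  by apply: addr_ge0; rewrite ?le_max ?lexx ?orbT ?subr_ge0.
- by move=> alpha c a01; exact: tail_integral_le.
- by move=> alpha a01; exists (quantile (cdfR A) alpha);
  exact: tail_integral_eq.
Qed.

Variable eps : R.
Hypothesis eps_gt0 : 0 < eps.

Let in01 alpha : eps <= alpha <= 1 - eps -> 0 < alpha < 1.
Proof. by move=> /andP[? ?]; apply/andP; split; have := eps_gt0; lra. Qed.

Lemma tail_dual_upper F H alpha : tail_dual F H -> eps <= alpha <= 1 - eps ->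
  tail_integral alpha F <= H 0.
Proof.
by move=> FH ea; have := dual_le FH 0 (in01 ea); rewrite mulr0 add0r.
Qed.

(** Write the dual value as [alpha * H c + (1 - alpha) * (H c + c)], a sum of two nonnegative terms.
    If [c <= 0], then [H c >= H 0] and the first term is at least [alpha * H 0]; if [c >= 0], then
    [H c + c >= H 0] and the second is at least [(1 - alpha) * H 0]. *)
Lemma tail_dual_lower F H alpha : tail_dual F H -> eps <= alpha <= 1 - eps ->
  eps * H 0 <= tail_integral alpha F.
Proof.
move=> FH ea; have [c ->] := dual_eq FH (in01 ea).
case/andP: ea => ea ae.
have Hc := dual_ge0 FH c; have HNc := dual_geN FH c; have H0 := dual_ge0 FH 0.
have [c0|/ltW c0] := leP c 0.
  have Hc0 := dual_anti FH c0.
  have : 0 <= (alpha - eps) * H 0 by rewrite mulr_ge0// subr_ge0.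
  have : 0 <= alpha * (H c - H 0) by rewrite mulr_ge0 ?subr_ge0//;
    have := eps_gt0; lra.
  have : 0 <= (1 - alpha) * (H c + c) by rewrite mulr_ge0//; have := eps_gt0;
    lra.
  lra.
have Hc0 := dual_lip FH c0.
have : 0 <= (1 - alpha - eps) * H 0 by rewrite mulr_ge0//; lra.
have : 0 <= alpha * H c by rewrite mulr_ge0//; have := eps_gt0; lra.
have : 0 <= (1 - alpha) * (H c + c - H 0).
  by rewrite mulr_ge0//; have := eps_gt0; lra.
lra.
Qed.

(* The minimizer [c] satisfies [eps * `|c| <= H 0], so that it suffices to
   compare [H] and [H'] on a compact interval. *)
Let tail_dual_close1 F H F' H' (M eta alpha : R) :
  tail_dual F H -> tail_dual F' H' -> H 0 <= eps * M ->
  (forall c, `|c| <= M -> `|H c - H' c| <= eta) ->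
  eps <= alpha <= 1 - eps ->
  tail_integral alpha F' <= tail_integral alpha F + eta.
Proof.
move=> FH FH' HM HH ea; have := tail_dual_upper FH ea.
have [c cE] := dual_eq FH (in01 ea); rewrite cE => up.
have := dual_le FH' c (in01 ea).
case/andP: ea => ea ae.
have Hc := dual_ge0 FH c; have HNc := dual_geN FH c.
have cM : `|c| <= M.
  rewrite -(ler_pM2l eps_gt0); apply: le_trans HM; apply: le_trans up.
  have [c0|/ltW c0] := leP 0 c.
    rewrite ger0_norm//.
    have : 0 <= (1 - alpha - eps) * c by rewrite mulr_ge0//; lra.
    lra.
  (* For [c <= 0] the dual value is [(H c + c) - alpha * c], whose first term is nonnegative. *)
  rewrite ler0_norm//.
  have : 0 <= alpha * (H c + c) by rewrite mulr_ge0//; have := eps_gt0; lra.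
  have : 0 <= (1 - alpha) * (H c + c) by rewrite mulr_ge0//; have := eps_gt0;
    lra.
  have : 0 <= (alpha - eps) * (- c) by rewrite mulr_ge0//; lra.
  lra.
have := HH c cM; rewrite ler_norml => /andP[? ?].
lra.
Qed.

Lemma tail_dual_close F H F' H' (M eta alpha : R) :
  tail_dual F H -> tail_dual F' H' -> H 0 <= eps * M -> H' 0 <= eps * M ->
  (forall c, `|c| <= M -> `|H c - H' c| <= eta) ->
  eps <= alpha <= 1 - eps ->
  `|tail_integral alpha F - tail_integral alpha F'| <= eta.
Proof.
move=> FH FH' HM HM' HH ea.
have h1 := tail_dual_close1 FH FH' HM HH ea.
have h2 : tail_integral alpha F <= tail_integral alpha F' + eta.
  by apply: (tail_dual_close1 FH' FH HM' _ ea) => c cM; rewrite distrC HH.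
by rewrite ler_norml; apply/andP; split; lra.
Qed.

(** The perturbed denominator keeps at least half of [d0]. The two summands of the constant come
    from the change of numerator, over [D'], and from the change of denominator, over [D * D']. *)
Lemma ratio_close (N D N' D' K d0 eta : R) :
  0 < d0 -> 0 <= N <= K -> d0 <= D -> `|N - N'| <= eta -> `|D - D'| <= eta ->
  eta <= d0 / 2 ->
  `|N / D - N' / D'| <= eta * (2 / d0 + 2 * K / d0 ^+ 2).
Proof.
move=> d00 /andP[N0 NK] dD NN' DD' ed.
have D0 := lt_le_trans d00 dD.
have dD' : d0 / 2 <= D'.
  by move: DD'; rewrite ler_norml => /andP[? ?]; lra.
have D'0 : 0 < D' by apply: lt_le_trans dD'; rewrite divr_gt0.
have -> : N / D - N' / D' = (N - N') / D' + N * (D' - D) / (D * D').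
  by field; rewrite !gt_eqF.
have iD' : D'^-1 <= 2 / d0.
  by rewrite -[leRHS]invrK lef_pV2 ?posrE// ?invr_gt0 ?divr_gt0// invfM invrK
    mulrC.
have iD : D^-1 <= d0^-1 by rewrite lef_pV2.
apply: le_trans (ler_normD _ _) _; rewrite (mulrDr eta); apply: lerD.
  rewrite normrM normfV (gtr0_norm D'0); apply: ler_pM => //.
  by rewrite invr_ge0 ltW.
rewrite !normrM normfV normrM (gtr0_norm D'0) (gtr0_norm D0) (ger0_norm N0).
rewrite (_ : eta * _ = K * eta * (d0^-1 * (2 / d0))); last by field;
  rewrite gt_eqF.
apply: ler_pM => //.
- by rewrite mulr_ge0.
- by rewrite invr_ge0 mulr_ge0 ?ltW.
- by apply: ler_pM => //; rewrite distrC.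
- by rewrite invfM; apply: ler_pM => //; rewrite invr_ge0 ltW.
Qed.

(** Nonnegativity of [f] supplies the lower bound that keeps [inf] from being a default value. *)
Lemma inf_le_add (S : set R) (f g : R -> R) (delta : R) :
  S !=set0 -> (forall s, S s -> 0 <= f s) -> (forall s, S s ->
    f s <= g s + delta) ->
  inf [set f s | s in S] <= inf [set g s | s in S] + delta.
Proof.
move=> [s0 Ss0] f0 fg; rewrite -lerBlDr.
apply: lb_le_inf; first by exists (g s0); exists s0.
move=> _ [s Ss <-]; rewrite lerBlDr; apply: le_trans (fg _ Ss).
by apply: ge_inf; [exists 0 => _ [t St <-]; exact: f0|exists s].
Qed.

Hypothesis eps_lt : eps < 2^-1.

Let itv0 : [set` `[eps, 1 - eps]] !=set0.
Proof.
exists eps => /=; rewrite in_itv/= lexx/=.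
have : eps * 2 < 1 by rewrite -ltr_pdivlMr ?div1r.
lra.
Qed.

Lemma ratioR_ge0 F H G HG alpha : tail_dual F H -> tail_dual G HG ->
  eps <= alpha <= 1 - eps -> 0 <= ratioR alpha F G.
Proof.
move=> FH GH ea; apply: mulr_ge0; rewrite ?invr_ge0.
  by apply: le_trans (tail_dual_lower FH ea);
    rewrite mulr_ge0 ?(dual_ge0 FH) ?ltW.
by apply: le_trans (tail_dual_lower GH ea);
  rewrite mulr_ge0 ?(dual_ge0 GH) ?ltW.
Qed.

Lemma Seps_ge0 F H G HG : tail_dual F H -> tail_dual G HG -> 0 <= Seps eps F G.
Proof.
move=> FH GH; have [a aI] := itv0.
apply: lb_le_inf; first by exists (ratioR a F G); exists a.
by move=> _ [s + <-]; rewrite /= in_itv/= => ea; exact: ratioR_ge0 FH GH ea.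
Qed.

Lemma Seps_close F H G HG F' H' G' HG' (K h0 M eta : R) :
  tail_dual F H -> tail_dual G HG -> tail_dual F' H' -> tail_dual G' HG' ->
  0 < h0 -> H 0 <= K -> h0 <= HG 0 <= K -> eps * M = K + 1 ->
  eta <= 1 -> eta <= eps * h0 / 2 ->
  (forall c, `|c| <= M -> `|H c - H' c| <= eta) ->
  (forall c, `|c| <= M -> `|HG c - HG' c| <= eta) ->
  `|Seps eps F G - Seps eps F' G'| <=
    eta * (2 / (eps * h0) + 2 * K / (eps * h0) ^+ 2).
Proof.
move=> FH GH FH' GH' h00 HK /andP[hG GK] eM eta1 etah HH HGG.
have M0 : 0 <= M.
  have : 0 <= eps * M by rewrite eM; have := dual_ge0 FH 0; lra.
  by rewrite pmulr_rge0.
(* The 1 in [eps * M = K + 1] absorbs the error [eta <= 1] at [c = 0], so the same compact range of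
   [c] serves for the perturbed functions. *)
have HK' : H' 0 <= eps * M.
  by have := HH 0; rewrite normr0 => /(_ M0);
    rewrite ler_norml eM => /andP[? ?]; lra.
have GK' : HG' 0 <= eps * M.
  by have := HGG 0; rewrite normr0 => /(_ M0);
    rewrite ler_norml eM => /andP[? ?]; lra.
set delta := eta * _.
have close alpha : eps <= alpha <= 1 - eps ->
    `|ratioR alpha F G - ratioR alpha F' G'| <= delta.
  (* By [tail_dual_lower] the denominator is at least [eps * h0] whatever [alpha]; this is the [d0]
     of [ratio_close]. *)
  move=> ea; apply: ratio_close => //.
  - by rewrite mulr_gt0.
  - rewrite (le_trans _ (tail_dual_lower FH ea)) ?(le_trans (tail_dual_upper FH
    ea))//.
    by rewrite mulr_ge0 ?(dual_ge0 FH)// ltW.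
  - by apply: le_trans (tail_dual_lower GH ea); rewrite ler_pM2l.
  - by apply: (tail_dual_close FH FH' _ HK' HH ea); rewrite eM; lra.
  - by apply: (tail_dual_close GH GH' _ GK' HGG ea); rewrite eM; lra.
have c1 : Seps eps F G <= Seps eps F' G' + delta.
  apply: inf_le_add => //= s; rewrite /= in_itv/= => ea;
    first exact: ratioR_ge0 FH GH ea.
  by have := close _ ea; rewrite ler_distl => /andP[].
have c2 : Seps eps F' G' <= Seps eps F G + delta.
  apply: inf_le_add => //= s; rewrite /= in_itv/= => ea;
    first exact: ratioR_ge0 FH' GH' ea.
  by have := close _ ea; rewrite ler_distlC => /andP[].
by rewrite ler_distl lerBlDr c1 c2.
Qed.

End tail_dual.

Section hausdorff_Bset.
Context {R : realType} {p : nat}.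

Lemma enorm_ge0 (u : 'rV[R]_p) : 0 <= enorm u.
Proof. exact: sqrtr_ge0. Qed.

Lemma enormZ (a : R) (u : 'rV[R]_p) : enorm (a *: u) = `|a| * enorm u.
Proof.
rewrite /enorm (_ : dot _ _ = a ^+ 2 * dot u u).
  by rewrite sqrtrM ?sqr_ge0// sqrtr_sqr.
by rewrite /dot mulr_sumr; apply: eq_bigr => j _; rewrite !mxE; ring.
Qed.

Let dist_Bset eps (F F' : R -> R) (G G' : 'rV[R]_p -> R -> R) (delta : R) v :
  (forall q, enorm q = 1 -> 0 <= Seps eps F' (G' q) /\
    Seps eps F (G q) <= Seps eps F' (G' q) + delta) ->
  0 <= delta -> Bset eps F G v ->
  exists2 u, Bset eps F' G' u & enorm (u - v) <= delta.
Proof.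
move=> close delta0 [lam [q [q1 /andP[lam0 lamS] ->]]].
have [S'0 SS'] := close q q1.
(* The approximating point stays on the ray of [q], with its radius cut down to the bound of the
   other set. *)
exists (Num.min lam (Seps eps F' (G' q)) *: q).
  exists (Num.min lam (Seps eps F' (G' q))), q; split => //.
  by rewrite le_min lam0 S'0 ge_min lexx orbT.
rewrite -scalerBl enormZ q1 mulr1 distrC ger0_norm; last first.
  by rewrite subr_ge0 ge_min lexx.
rewrite lerBlDr -lerBlDl le_min !lerBlDl lerDr delta0/=.
by rewrite (le_trans lamS)// addrC.
Qed.

Lemma hausdorff_Bset_le eps (F F' : R -> R) (G G' : 'rV[R]_p -> R -> R)
    (delta : R) : 0 <= delta ->
  (forall q, enorm q = 1 -> [/\ 0 <= Seps eps F (G q), 0 <= Seps eps F' (G' q) &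
    `|Seps eps F (G q) - Seps eps F' (G' q)| <= delta]) ->
  (hausdorff (Bset eps F' G') (Bset eps F G) <= delta%:E)%E.
Proof.
move=> delta0 close; rewrite /hausdorff ge_max; apply/andP; split.
  apply: ge_ereal_sup => _ [v Bv <-].
  have [|u Bu uv] := @dist_Bset eps F F' G G' delta v _ delta0 Bv.
    by move=> q /close[_ ?]; rewrite ler_distl => /andP[].
  by apply: ereal_inf_le; exists (enorm (u - v))%:E; [exists u|rewrite lee_fin].
apply: ge_ereal_sup => _ [v Bv <-].
have [|u Bu uv] := @dist_Bset eps F' F G' G delta v _ delta0 Bv.
  by move=> q /close[? _]; rewrite ler_distlC => /andP[].
apply: ereal_inf_le; exists (enorm (v - u))%:E; first by exists u.
by rewrite lee_fin -opprB -scaleN1r enormZ normrN1 mul1r.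
Qed.

End hausdorff_Bset.

(** * Uniform convergence of the excess functions *)

Lemma ler_max0B (R : realDomainType) (x y c c' : R) :
  `|Num.max (x - c) 0 - Num.max (y - c') 0| <= `|x - y| + `|c - c'|.
Proof.
apply: (@le_trans _ _ `|(x - c) - (y - c')|).
  move: (x - c) (y - c') => s t.
  have [s0|/ltW s0] := leP 0 s; have [t0|/ltW t0] := leP 0 t.
  - by [].
  - by rewrite subr0 !ger0_norm//; lra.
  - by rewrite sub0r normrN distrC !ger0_norm//; lra.
  - by rewrite subrr normr0.
rewrite (_ : x - c - _ = (x - y) - (c - c')); last by ring.
exact: ler_normB.
Qed.

Lemma avg_le (R : realFieldType) n (f g : nat -> R) : (0 < n)%N ->
  (forall i, f i <= g i) ->
  n%:R^-1 * \sum_(i < n) f i <= n%:R^-1 * \sum_(i < n) g i.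
Proof.
move=> n0 fg; rewrite ler_pM2l ?invr_gt0 ?ltr0n//.
by apply: ler_sum => i _; exact: fg.
Qed.

Lemma avg_cst (R : numFieldType) n (c : R) : (0 < n)%N ->
  n%:R^-1 * \sum_(i < n) c = c.
Proof.
move=> n0; rewrite sumr_const card_ord -[c *+ n]mulr_natl mulrA mulVf ?mul1r//.
by rewrite pnatr_eq0 -lt0n.
Qed.

Section uniform_excess.
Context {R : realType} {d d' dE : measure_display} {T : measurableType d}
  {Om : measurableType d'} {E : measurableType dE}.
Variables (P : probability T R) (Q : probability Om R).
Variables (Z : {RV P >-> E}) (Zs : nat -> {RV Q >-> E}).
Hypothesis law : forall i, same_law (Zs i) Z.
Hypothesis indep : mutually_independent Q Zs.
Variables (V : pseudoMetricType R) (K : set V) (a : V -> E -> R) (l : E -> R).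
Hypothesis cK : compact K.
Hypothesis ma : forall v, measurable_fun setT (a v).
Hypothesis ml : measurable_fun setT l.
Hypothesis a2 : forall v, a v \o Z \in Lfun P 2%:E.
Hypothesis l2 : l \o Z \in Lfun P 2%:E.
Hypothesis lip :
  forall v v' r z, ball v r v' -> `|a v z - a v' z| <= l z * r.
Hypothesis al : forall v z, K v -> `|a v z| <= l z.

Definition pop_mean v := \int[P]_x a v (Z x).
Definition pop_excess v c := \int[P]_x Num.max (a v (Z x) - pop_mean v - c) 0.
Definition emp_mean n w v := n%:R^-1 * \sum_(i < n) a v (Zs i w).
Definition emp_excess n w v c :=
  n%:R^-1 * \sum_(i < n) Num.max (a v (Zs i w) - emp_mean n w v - c) 0.

Lemma integrable_direction v : P.-integrable setT (EFin \o (a v \o Z)).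
Proof. by apply/Lfun1_integrable/Lfun2_Lfun1. Qed.

Let il : P.-integrable setT (EFin \o (l \o Z)).
Proof. by apply/Lfun1_integrable/Lfun2_Lfun1. Qed.

Lemma pop_mean_le v : K v -> `|pop_mean v| <= \int[P]_x l (Z x).
Proof.
move=> Kv; apply: le_trans (le_normr_Rintegral measurableT
  (integrable_direction v)) _.
apply: le_Rintegral => //;
  first exact: integrable_norm (integrable_direction v).
by move=> x _; exact: al.
Qed.

(** Half of [eta] pays for replacing the sample mean by [pop_mean v], the other half for the uniform
    law of the uncentered family [g] at the shift [pop_mean v + c]. That shift is at most [M + L] in
    absolute value, whence the range of the second index. *)
Lemma uniform_excess (M eta : R) : 0 < eta ->
  outer_null Q (fun n => [set w | exists v c, [/\ K v, `|c| <= M &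
    eta < `|pop_excess v c - emp_excess n w v c| ]]).
Proof.
move=> eta0; set L := \int[P]_x l (Z x).
pose g (vc : V * R) z := Num.max (a vc.1 z - vc.2) 0.
have mg vc : measurable_fun setT (g vc) by exact: measurable_excess.
have l1 : (fun z => l z + 1) \o Z \in Lfun P 2%:E.
  by apply: (Lfun2D (g := cst 1) l2); exact: Lfun_cst.
have n2 (f : T -> R) : f \in Lfun P 2%:E -> (fun x => `|f x|) \in Lfun P 2%:E.
  move=> f2; apply: (Lfun2_dominated _ f2) => [|x]; last by rewrite normr_id.
  by apply: measurableT_comp => //; exact: Lfun_measurable f2.
have g2 vc : g vc \o Z \in Lfun P 2%:E.
  apply: (@Lfun2_dominated _ _ _ _ _
    ((fun x => `|a vc.1 (Z x)|) \+ cst `|vc.2|)).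
  - exact: measurableT_comp.
  - by apply: Lfun2D; [apply: n2; exact: a2|exact: Lfun_cst].
  - move=> x; rewrite /g/= ger0_norm ?le_max ?lexx ?orbT//.
    rewrite ger0_norm ?addr_ge0// ge_max addr_ge0// andbT.
    by rewrite (le_trans (ler_norm _))// ler_normB.
have A0 := @uniform_weak_law _ _ _ _ _ _ _ P Q Z Zs law indep V K a l (eta / 2)
  cK ma ml a2 l2 lip (divr_gt0 eta0 (ltr0n _ 2)).
have cKM : compact (K `*` `[- (M + L), M + L]).
  by apply: compact_setX => //; exact: segment_compact.
(* The Lipschitz constant adds [l z] for the direction and 1 for the shift. *)
have lipg (v v' : V * R) r z : ball v r v' ->
  `|g v z - g v' z| <= (l z + 1) * r.
  move=> [b1 b2]; apply: le_trans (ler_max0B _ _ _ _) _.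
  rewrite mulrDl mul1r; apply: lerD; first exact: lip.
  exact: ltW.
have ml1 : measurable_fun setT (fun z => l z + 1) by exact: measurable_funD.
have B0 := @uniform_weak_law _ _ _ _ _ _ _ P Q Z Zs law indep _
  (K `*` `[- (M + L), M + L]) g (fun z => l z + 1) (eta / 2)
  cKM mg ml1 g2 l1 lipg (divr_gt0 eta0 (ltr0n _ 2)).
apply: outer_null_sub (outer_nullU A0 B0).
near=> n => w /= [v [c [Kv cM]]]; apply: contraPP => /not_orP[nA nB].
apply/negP; rewrite -leNgt.
have n0 : (0 < n)%N by near: n; exact: nbhs_infty_gt.
have mm : `|emp_mean n w v - pop_mean v| <= eta / 2.
  by rewrite leNgt; apply/negP => H; apply: nA; exists v.
have hh : `|n%:R^-1 * \sum_(i < n) Num.max (a v (Zs i w) - (pop_mean v + c)) 0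
    - pop_excess v c| <= eta / 2.
  rewrite leNgt; apply/negP => H; apply: nB; exists (v, pop_mean v + c).
    split => //=; rewrite in_itv/= -ler_norml (le_trans (ler_normD _ _))//.
    by rewrite addrC lerD// pop_mean_le.
  rewrite /g/= (_ : Rintegral _ _ _ = pop_excess v c)//.
  by apply: eq_Rintegral => x _; rewrite opprD addrA.
have hm : `|n%:R^-1 * \sum_(i < n) Num.max (a v (Zs i w) - (pop_mean v + c)) 0
    - emp_excess n w v c| <= eta / 2.
  rewrite /emp_excess -mulrBr -sumrB normrM gtr0_norm ?invr_gt0 ?ltr0n//.
  rewrite -[leRHS](@avg_cst _ n)//.
  apply: (@le_trans _ _ (n%:R^-1 * \sum_(i < n) `|Num.max
      (a v (Zs i w) - (pop_mean v + c)) 0 -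
      Num.max (a v (Zs i w) - emp_mean n w v - c) 0|)).
    by rewrite ler_pM2l ?invr_gt0 ?ltr0n//; exact: ler_norm_sum.
  apply: (@avg_le _ n (fun i => `|Num.max (a v (Zs i w) - (pop_mean v + c)) 0 -
      Num.max (a v (Zs i w) - emp_mean n w v - c) 0|) (fun=> eta / 2)) => // i.
  rewrite -[_ - emp_mean n w v - c]addrA -opprD.
  apply: le_trans (ler_max0B _ _ _ _) _; rewrite subrr normr0 add0r.
  by rewrite distrC (_ : _ - _ = emp_mean n w v - pop_mean v)//; ring.
rewrite distrC in hh; rewrite [leRHS]splitr.
exact: le_trans (ler_distD _ _ _) (lerD hh hm).
Unshelve. all: by end_near. Qed.

Let integrable_pop_excess v c :
  P.-integrable setT (EFin \o (fun x =>
    Num.max (a v (Z x) - pop_mean v - c) 0)).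
Proof.
have := @integrable_excess _ _ _ P (rv P (Lfun_measurable (a2 v)))
  (integrable_direction v) (pop_mean v + c).
by apply: eq_integrable => // x _ /=; rewrite opprD addrA.
Qed.

Lemma pop_excess_le v : K v -> pop_excess v 0 <= 2 * \int[P]_x l (Z x).
Proof.
move=> Kv; set L := \int[P]_x l (Z x).
have iL : P.-integrable setT (EFin \o cst L) by exact:
  finite_measure_integrable_cst.
apply: (@le_trans _ _ (\int[P]_x (l (Z x) + L))).
  apply: le_Rintegral => //; first exact: (integrableD measurableT il iL).
  move=> x _; have := al (Z x) Kv; have := pop_mean_le Kv.
  rewrite -/L subr0 ge_max !ler_norml => /andP[? ?] /andP[? ?].
  by apply/andP; split; lra.
by rewrite RintegralD// Rintegral_prob_cst mulr_natl mulr2n.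
Qed.

(** Centering enters here: the positive part dominates [A - c], whose mean is [- c]. *)
Lemma pop_excess_geN v c : - c <= pop_excess v c.
Proof.
have im : P.-integrable setT (EFin \o cst (pop_mean v + c)).
  exact: finite_measure_integrable_cst.
have iB := integrableB measurableT (integrable_direction v) im.
have -> : - c = \int[P]_x (a v (Z x) - (pop_mean v + c)).
  rewrite RintegralB//; last exact: integrable_direction.
  by rewrite Rintegral_prob_cst opprD addrA subrr sub0r.
apply: le_Rintegral => //.
by move=> x _; rewrite opprD addrA le_max lexx.
Qed.

Lemma emp_excess_geN n w v c : (0 < n)%N -> - c <= emp_excess n w v c.
Proof.
move=> n0.
have -> : - c = n%:R^-1 * \sum_(i < n) (a v (Zs i w) - emp_mean n w v - c).
  by rewrite !sumrB !mulrBr !avg_cst// subrr sub0r.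
by apply: (@avg_le _ n (fun i => a v (Zs i w) - emp_mean n w v - c)
  (fun i => Num.max (a v (Zs i w) - emp_mean n w v - c) 0)) => // i;
    rewrite le_max lexx.
Qed.

Lemma tail_dual_pop v (A : {RV P >-> R}) :
  (forall x, A x = a v (Z x) - pop_mean v) ->
  tail_dual (cdfR A) (pop_excess v).
Proof.
move=> AE.
have eE c : excess A c = pop_excess v c.
  by apply: eq_Rintegral => x _; rewrite AE.
have <- : excess A = pop_excess v by apply/funext.
apply: tail_dual_excess => [|c]; last by rewrite eE; exact: pop_excess_geN.
have := integrableB measurableT (integrable_direction v)
  (finite_measure_integrable_cst P (pop_mean v) measurableT).
by apply: eq_integrable => // x _ /=; rewrite AE EFinB.
Qed.

Lemma tail_dual_emp n w v (F : R -> R) :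
  (forall t, F t = ecdf n.+1 (fun i => a v (Zs i w)) (t + emp_mean n.+1 w v)) ->
  tail_dual F (emp_excess n.+1 w v).
Proof.
(* Shifting the argument of the empirical cdf by the sample mean amounts to centering the sample, so
   [F] is the cdf of a genuine empirical law. *)
move=> FE; pose b i := a v (Zs i w) - emp_mean n.+1 w v.
have -> : F = cdfR (emp_rv n b).
  rewrite cdfR_emp; apply/funext => t; rewrite FE /ecdf; congr (_ * _).
  by apply: eq_bigr => i _; rewrite /b lerBlDr.
have eE : excess (emp_rv n b) = emp_excess n.+1 w v.
  by apply/funext => c; rewrite excess_emp.
rewrite -eE; apply: tail_dual_excess => [|c]; first exact: integrable_emp.
by rewrite eE; exact: emp_excess_geN.
Qed.

End uniform_excess.

(** * Directions on the sphere *)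

Lemma Rintegral_sum (R : realType) d (T : measurableType d)
    (mu : {measure set T -> \bar R}) (I : finType) (f : I -> T -> R) :
  (forall i, mu.-integrable setT (EFin \o f i)) ->
  \int[mu]_x (\sum_i f i x) = \sum_i \int[mu]_x f i x.
Proof.
move=> fi; rewrite /Rintegral sum_fine; last first.
  by move=> i _; exact: integrable_fin_num (fi i).
rewrite -integral_sum//; congr fine; apply: eq_integral => x _.
by rewrite sumEFin.
Qed.

Lemma continuous_sum_sqr (R : numFieldType) (T : topologicalType) (I : finType)
    (f : I -> T -> R) :
  (forall i, continuous (f i)) -> continuous (fun x => \sum_i f i x * f i x).
Proof.
move=> fc x; elim: (index_enum _) => [|i s IH].
  rewrite (_ : (fun _ => _) = cst 0); first exact: cvg_cst.
  by apply/funext => y; rewrite big_nil.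
rewrite (_ : (fun _ => _) = fun y =>
  f i y * f i y + \sum_(j <- s) f j y * f j y);
  last first.
  by apply/funext => y; rewrite big_cons.
by apply: cvgD => //; apply: cvgM; exact: fc.
Qed.

(** The image of [K] is compact, hence closed, and misses 0; the radius of a ball around 0 that
    avoids it is the bound. This covers an empty [K], such as the unit sphere for [p = 0]. *)
Lemma lipschitz_compact_min (R : realType) (V : pseudoMetricType R) (K : set V)
    (f : V -> R) (C : R) : compact K -> 0 <= C ->
  (forall v v' r, ball v r v' -> `|f v - f v'| <= C * r) ->
  (forall v, K v -> 0 < f v) ->
  exists2 h, 0 < h & forall v, K v -> h <= f v.
Proof.
move=> cK C0 flip f0.
have fc : continuous f.
  move=> q; apply/cvgrPdist_le => e e0.
  have r0 : 0 < e / (C + 1) by rewrite divr_gt0// ltr_wpDl.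
  near=> q'.
  have : ball q (e / (C + 1)) q' by near: q'; exact: nbhsx_ballx.
  move=> /flip /le_trans; apply.
  by rewrite mulrA ler_pdivrMr ?ltr_wpDl// mulrC ler_pM2l// lerDl.
have clim : closed (f @` K).
  apply: compact_closed; first exact: Rhausdorff.
  by apply: continuous_compact => //; exact: continuous_subspaceT.
have n0 : (~` (f @` K)) 0.
  by move=> [v /f0 + fv]; rewrite fv ltxx.
have : nbhs (0 : R) (~` (f @` K)).
  by apply: open_nbhs_nbhs; split => //; exact: closed_openC.
move=> /nbhs_ballP[e /= e0 eS].
exists e => // v Kv; rewrite leNgt; apply/negP => fe.
apply: (eS (f v)); last by exists v.
by rewrite /ball/= sub0r normrN gtr0_norm// f0.
Unshelve. all: by end_near. Qed.

Section sphere.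
Context {R : realType} {p : nat}.
Implicit Types u v : 'rV[R]_p.

Lemma dot_ge0 u : 0 <= dot u u.
Proof. by apply: sumr_ge0 => j _; rewrite -expr2 sqr_ge0. Qed.

Lemma enorm_sqr u : enorm u ^+ 2 = dot u u.
Proof. by rewrite sqr_sqrtr// dot_ge0. Qed.

Lemma coord_le_enorm u j : `|u 0 j| <= enorm u.
Proof.
rewrite -sqrtr_sqr /enorm ler_wsqrtr// /dot (bigD1 j)//= -expr2 lerDl.
by apply: sumr_ge0 => i _; rewrite -expr2 sqr_ge0.
Qed.

Lemma coord_le_norm u j : `|u 0 j| <= `|u|.
Proof.
have -> : `|u| = mx_norm u by [].
rewrite mx_normrE.
exact: (@le_bigmax _ _ _ _ (fun ij : 'I_1 * 'I_p => `|u ij.1 ij.2|) (0, j)).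
Qed.

Lemma normr_le_enorm u : `|u| <= enorm u.
Proof.
have -> : `|u| = mx_norm u by [].
rewrite mx_normrE; apply: bigmax_le; first exact: sqrtr_ge0.
by move=> [i j] _ /=; rewrite ord1 coord_le_enorm.
Qed.

Lemma dot_le u v : `|dot u v| <= (\sum_j `|u 0 j|) * `|v|.
Proof.
rewrite mulr_suml; apply: le_trans (ler_norm_sum _ _ _) _.
by apply: ler_sum => j _; rewrite normrM ler_wpM2l// coord_le_norm.
Qed.

Lemma dotBr u v v' : dot u (v - v') = dot u v - dot u v'.
Proof. by rewrite -sumrB; apply: eq_bigr => j _; rewrite !mxE mulrBr. Qed.

Lemma dotBl u u' v : dot (u - u') v = dot u v - dot u' v.
Proof. by rewrite -sumrB; apply: eq_bigr => j _; rewrite !mxE mulrBl. Qed.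

Lemma sphere_compact : compact [set q : 'rV[R]_p | enorm q = 1].
Proof.
apply: bounded_closed_compact.
  exists 1; split => // M M1 q /= q1;
    rewrite (le_trans (normr_le_enorm _))// q1.
  exact: ltW.
rewrite (_ : [set q | _] = (fun q : 'rV[R]_p => dot q q) @^-1` [set 1]).
  apply: closed_comp; last first.
    by apply: accessible_closed_set1; apply: hausdorff_accessible;
      exact: Rhausdorff.
  move=> q _; apply: (continuous_sum_sqr (f := fun j (v : 'rV[R]_p) => v 0 j)).
  by move=> j; exact: coord_continuous.
apply/seteqP; split => q /=; first by rewrite -enorm_sqr => ->; rewrite expr1n.
by rewrite /enorm => ->; rewrite sqrtr1.
Qed.

End sphere.

Local Notation coord := Defs.coord.

Section linear_directions.
Context {R : realType} {d : measure_display} {T : measurableType d} {p : nat}.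
Variables (P : probability T R) (X : {RV P >-> p.-tuple R}).
Hypothesis X2 : ('E_P[(fun w => enorm (rowt (X w)) ^+ 2)%R] < +oo)%E.

Let a (q : 'rV[R]_p) (z : p.-tuple R) := dot (rowt z) q.
(** Balls of the row space are those of the sup norm, whose dual norm is this l1 norm; it is
    therefore the Lipschitz constant of [a] in [q]. *)
Let l (z : p.-tuple R) := \sum_(j < p) `|rowt z 0 j|.

Lemma measurable_rowt j : measurable_fun setT (fun z : p.-tuple R =>
  rowt z 0 j).
Proof.
rewrite (_ : (fun _ => _) = fun z => tnth z j); first exact: measurable_tnth.
by apply/funext => z; rewrite mxE.
Qed.

Lemma measurable_dot q : measurable_fun setT (a q).
Proof.
by apply: measurable_sum => j; apply: measurable_funM => //;
  exact: measurable_rowt.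
Qed.

Lemma measurable_l1 : measurable_fun setT l.
Proof.
apply: measurable_sum => j; apply: measurableT_comp => //;
  exact: measurable_rowt.
Qed.

Lemma l1_Lfun2 : l \o X \in Lfun P 2%:E.
Proof.
apply: Lfun2P; first by apply: measurableT_comp => //; exact: measurable_l1.
have mdot : measurable_fun setT (fun z : p.-tuple R => dot (rowt z) (rowt z)).
  by apply: measurable_sum => j; apply: measurable_funM; exact: measurable_rowt.
apply: (@le_integrable _ _ _ P _ measurableT _
    (EFin \o (fun w => p%:R ^+ 2 * dot (rowt (X w)) (rowt (X w))))).
- apply/measurable_EFinP; apply: measurable_funX.
  by apply: measurableT_comp => //; exact: measurable_l1.
- move=> w _ /=; rewrite lee_fin ger0_norm ?sqr_ge0// ger0_norm; last first.
    by rewrite mulr_ge0 ?sqr_ge0// dot_ge0.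
  rewrite -enorm_sqr -exprMn ler_sqr ?nnegrE ?mulr_ge0 ?enorm_ge0//; last first.
    by apply: sumr_ge0.
  rewrite -[p in p%:R]card_ord -sumr_const mulr_suml.
  by apply: ler_sum => j _; rewrite mul1r coord_le_enorm.
- apply: (integrableZl measurableT (p%:R ^+ 2)
    (f := fun w => (dot (rowt (X w)) (rowt (X w)))%:E)).
  apply/integrableP; split.
    apply/measurable_EFinP.
    exact: (measurableT_comp (f := fun z : p.-tuple R =>
      dot (rowt z) (rowt z))).
  move: X2; rewrite unlock; apply: le_lt_trans.
  rewrite le_eqVlt; apply/orP; left; apply/eqP; apply: eq_integral => w _ /=.
  by rewrite ger0_norm ?dot_ge0// enorm_sqr.
Qed.

Lemma dot_Lfun2 q : a q \o X \in Lfun P 2%:E.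
Proof.
have l2 : `|q| \o* (l \o X) \in Lfun P 2%:E.
  by rewrite Lfun_scale ?ler1n// l1_Lfun2.
apply: (Lfun2_dominated _ l2).
  by apply: measurableT_comp => //; exact: measurable_dot.
move=> w; apply: le_trans (dot_le _ _) _.
by rewrite -/(l (X w)); exact: ler_norm.
Qed.

Lemma dot_lip (q q' : 'rV[R]_p) r z : ball q r q' ->
  `|a q z - a q' z| <= l z * r.
Proof.
rewrite -ball_normE => qq'; rewrite /a -dotBr; apply: le_trans (dot_le _ _) _.
by apply: ler_wpM2l; [apply: sumr_ge0|exact: ltW].
Qed.

Lemma dot_sphere_le (q : 'rV[R]_p) z : enorm q = 1 -> `|a q z| <= l z.
Proof.
move=> q1; apply: le_trans (dot_le _ _) _.
rewrite -[leRHS]mulr1 ler_wpM2l ?sumr_ge0//.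
by rewrite (le_trans (normr_le_enorm _))// q1.
Qed.

Lemma coordE j w : coord X j w = rowt (X w) 0 j.
Proof. by rewrite mxE. Qed.

Lemma coord_Lfun2 j : coord X j \in Lfun P 2%:E.
Proof.
apply: (Lfun2_dominated _ l1_Lfun2) => [|w].
  exact: (measurableT_comp (measurable_tnth j)).
rewrite coordE /l /= [leRHS]ger0_norm ?sumr_ge0// (bigD1 j)//= lerDl sumr_ge0//.
Qed.

Let iE (f : T -> R) : f \in Lfun P 2%:E -> P.-integrable setT (EFin \o f).
Proof. by move=> f2; apply/Lfun1_integrable/Lfun2_Lfun1. Qed.

Lemma dot_mean_vec q : dot (mean_vec P X) q = \int[P]_x a q (X x).
Proof.
rewrite Rintegral_sum; last first.
  move=> j; apply: eq_integrable (integrableZr measurableT (q 0 j) (iE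
    (coord_Lfun2 j))) => //.
  by move=> w _ /=; rewrite coordE.
apply: eq_bigr => j _; rewrite mxE unlock.
under [RHS]eq_Rintegral do rewrite -coordE.
by rewrite RintegralZr//; exact: iE (coord_Lfun2 j).
Qed.

Lemma center_dotE q w : center_dot P X q w = a q (X w) - \int[P]_x a q (X x).
Proof. by rewrite /center_dot dotBl dot_mean_vec. Qed.

Let A q w := center_dot P X q w.

Let A2 q : A q \in Lfun P 2%:E.
Proof.
rewrite (_ : A q = fun w => (a q \o X) w + cst (- \int[P]_x a q (X x)) w).
  by apply: Lfun2D; [exact: dot_Lfun2|exact: Lfun_cst].
by apply/funext => w; rewrite /A center_dotE.
Qed.

(** As |A| is twice the positive part of A minus A, a centered projection with null positive part
    vanishes almost everywhere. Its covariances with all coordinates, which form [q *m cov_mx P X],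
    are then 0. *)
Lemma center_dot_eq0 q : cov_mx P X \in unitmx ->
  \int[P]_w Num.max (A q w) 0 = 0 -> q = 0.
Proof.
move=> covU E0.
have iA := iE (A2 q).
have EA : \int[P]_w A q w = 0.
  under eq_Rintegral do rewrite /A center_dotE.
  rewrite RintegralB//; [|exact: iE (dot_Lfun2 q)|exact:
    finite_measure_integrable_cst].
  by rewrite Rintegral_prob_cst subrr.
have iM : P.-integrable setT (EFin \o (fun w => Num.max (A q w) 0)).
  have := @integrable_excess _ _ _ P (rv P (Lfun_measurable (A2 q))) iA 0.
  by apply: eq_integrable => // w _ /=; rewrite subr0.
have Eabs : \int[P]_w `|A q w| = 0.
  transitivity (\int[P]_w ((Num.max (A q w) 0 + Num.max (A q w) 0) - A q w)).
    apply: eq_Rintegral => w _; have [h|/ltW h] := leP 0 (A q w).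
      by rewrite ger0_norm// addrK.
    by rewrite ler0_norm// addr0 sub0r.
  rewrite RintegralB//; last exact: (integrableD measurableT iM iM).
  by rewrite RintegralD// E0 EA !addr0 subr0.
have ae0 : ae_eq P setT (EFin \o A q) (cst 0%E).
  apply/(ae_eq_integral_abs P measurableT); first exact: measurable_int iA.
  have : (\int[P]_w `|A q w|%:E)%E = (\int[P]_w `|A q w|)%:E.
    by rewrite /Rintegral fineK//;
      exact: integrable_fin_num (integrable_norm iA).
  by rewrite Eabs.
pose C j w := coord X j w - fine 'E_P[coord X j].
have C2 j : C j \in Lfun P 2%:E.
  by apply: (Lfun2D (g := cst (- fine 'E_P[coord X j])));
    [exact: coord_Lfun2|exact: Lfun_cst].
have iCC i j : P.-integrable setT (EFin \o (C i \* C j)).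
  by apply/Lfun1_integrable; exact: Lfun2_mul_Lfun1.
have AC w : A q w = \sum_i q 0 i * C i w.
  by rewrite /A /center_dot /dot; apply: eq_bigr => i _; rewrite !mxE mulrC.
have covE i j : cov_mx P X i j = \int[P]_w (C i w * C j w).
  by rewrite mxE covariance.unlock /C !expectation.unlock.
have qcov : q *m cov_mx P X = 0.
  apply/rowP => j; rewrite !mxE.
  transitivity (\int[P]_w (A q w * C j w)).
    under [RHS]eq_Rintegral do rewrite AC mulr_suml.
    rewrite Rintegral_sum; last first.
      move=> i; have := integrableZl measurableT (q 0 i) (iCC i j).
      by apply: eq_integrable => // w _ /=; rewrite -EFinM mulrA.
    apply: eq_bigr => i _; rewrite covE.
    under [RHS]eq_Rintegral do rewrite -mulrA.
    by rewrite RintegralZl//; exact: iCC.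
  rewrite /Rintegral (ae_eq_integral (cst 0%E))//.
  - by rewrite integral0.
  - by apply/measurable_EFinP; apply: measurable_funM;
    exact: Lfun_measurable (_ : _ \in Lfun P 2%:E).
  - apply: filterS ae0 => w /= /(_ I); rewrite /cst => -[->] _.
    by rewrite mul0r.
by rewrite -(mulmxK covU q) qcov mul0mx.
Qed.

Lemma excess_dot_bound : cov_mx P X \in unitmx ->
  exists2 h0, 0 < h0 & forall q, enorm q = 1 -> h0 <= pop_excess X a q 0.
Proof.
move=> covU.
pose f q := pop_excess X a q 0.
have fE q : f q = \int[P]_w Num.max (A q w) 0.
  by apply: eq_Rintegral => w _; rewrite /A center_dotE subr0.
have iM q : P.-integrable setT (EFin \o (fun w => Num.max (A q w) 0)).
  have := @integrable_excess _ _ _ P (rv P (Lfun_measurable (A2 q))) (iE (A2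
    q)) 0.
  by apply: eq_integrable => // w _ /=; rewrite subr0.
have il := iE l1_Lfun2.
set L := \int[P]_x l (X x).
have L0 : 0 <= L by apply: Rintegral_ge0 => w _; apply: sumr_ge0.
(* One [L] comes from the projection, the other from its mean. *)
have flip q q' r : ball q r q' -> `|f q - f q'| <= (2 * L) * r.
  move=> qq'; rewrite !fE -RintegralB//.
  have iB := integrableB measurableT (iM q) (iM q').
  apply: le_trans (le_normr_Rintegral measurableT iB) _.
  have AAle w : `|A q w - A q' w| <= l (X w) * r + L * r.
    rewrite /A !center_dotE (_ : _ - _ = (a q (X w) - a q' (X w)) -
      (\int[P]_x a q (X x) - \int[P]_x a q' (X x))); last by ring.
    apply: le_trans (ler_normB _ _) _; apply: lerD; first exact: dot_lip.
    rewrite -RintegralB//; try exact: iE (dot_Lfun2 _).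
    have iB' := integrableB measurableT (iE (dot_Lfun2 q)) (iE (dot_Lfun2 q')).
    apply: le_trans (le_normr_Rintegral measurableT iB') _.
    rewrite -RintegralZr//; apply: le_Rintegral => //.
    - exact: integrable_norm iB'.
    - exact: (integrableZr measurableT r il).
    - by move=> x _; exact: dot_lip.
  have iZ := integrableZr measurableT r il.
  have ic := finite_measure_integrable_cst P (L * r) measurableT.
  apply: (@le_trans _ _ (\int[P]_w (l (X w) * r + L * r))).
    apply: le_Rintegral => //.
    - exact: integrable_norm iB.
    - exact: (integrableD measurableT iZ ic).
    - move=> w _; have := ler_max0B (A q w) (A q' w) 0 0.
      by rewrite !subr0 normr0 addr0 => /le_trans; apply; exact: AAle.
  rewrite RintegralD// RintegralZr// Rintegral_prob_cst.
  by rewrite -/L -mulrDl mulr_natl mulr2n.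
apply: (lipschitz_compact_min (C := 2 * L) sphere_compact _ flip).
  by rewrite mulr_ge0.
move=> q q1; have f0 : 0 <= f q.
  by rewrite fE; apply: Rintegral_ge0 => w _; rewrite le_max lexx orbT.
rewrite lt_neqAle f0 andbT; apply/eqP => fq.
have q0 := center_dot_eq0 covU (etrans (esym (fE q)) (esym fq)).
move: q1; rewrite q0 /= /enorm /dot big1 ?sqrtr0 => [/eqP|j _]; last first.
  by rewrite mxE mul0r.
by rewrite eq_sym oner_eq0.
Qed.

End linear_directions.

(** * Consistency *)

(** The quotient is half the harmonic mean, at most either number since [a * b <= a * (a + b)]. If
    [a = b = 0] it is 0 by convention, which forces [N = 0]. *)
Lemma leq_harmonic (R : realFieldType) (a b N : nat) :
  N%:R <= (a * b)%:R / (a + b)%:R :> R -> (N <= a)%N /\ (N <= b)%N.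
Proof.
have [ab0|ab0] := posnP (a + b)%N.
  rewrite ab0 invr0 mulr0 (_ : 0 = 0%:R)// ler_nat leqn0 => /eqP ->; lia.
rewrite ler_pdivlMr ?ltr0n// -natrM ler_nat => H.
split; rewrite leqNgt; apply/negP => aN.
  have : (a.+1 * (a + b) <= N * (a + b))%N by rewrite leq_mul2r aN orbT.
  nia.
have : (b.+1 * (a + b) <= N * (a + b))%N by rewrite leq_mul2r aN orbT.
nia.
Qed.

Lemma dot_smean (R : realType) (p n : nat) (x : nat ->
  'rV[R]_p) (q : 'rV[R]_p) :
  dot (smean n x) q = n%:R^-1 * \sum_(i < n) dot (x i) q.
Proof.
rewrite /dot exchange_big mulr_sumr; apply: eq_bigr => j _.
by rewrite /smean mxE summxE -mulrA mulr_suml.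
Qed.

Theorem theorem2 (R : realType) (p : nat) (eps : R)
    (d : measure_display) (T : measurableType d) (P : probability T R)
    (Y : {RV P >-> R}) (X : {RV P >-> p.-tuple R})
    (alpha0 : R) (beta0 : 'rV[R]_p)
    (d' : measure_display) (Om : measurableType d') (Q : probability Om R)
    (Ys : nat -> {RV Q >-> R}) (Xs : nat -> {RV Q >-> p.-tuple R}) :
  0 < eps < 2^-1 ->
  ('E_P[(fun w => Y w ^+ 2)%R] < +oo)%E ->
  ('E_P[(fun w => enorm (rowt (X w)) ^+ 2)%R] < +oo)%E ->
  (0 < 'V_P[Y])%E ->
  cov_mx P X \in unitmx ->
  is_cond_exp P Y X (fun w => alpha0 + dot (rowt (X w)) beta0) ->
  (forall i, same_law (Ys i) Y) ->
  (forall i, same_law (Xs i) X) ->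
  mutually_independent Q Ys ->
  mutually_independent Q Xs ->
  independent_sigma Q (sigma_of_seq Ys) (sigma_of_seq Xs) ->
  forall nX nY : nat -> nat,
    ((nX k * nY k)%:R / (nX k + nY k)%:R : R) @[k --> \oo] --> +oo ->
    cvg_prob0 Q (fun k w =>
      hausdorff
        (Bhat eps (nY k) (nX k) (fun i => Ys i w) (fun i => rowt (Xs i w)))
        (Bpop eps Y X)).
Proof.
move=> /andP[eps0 eps1] Y2 X2 _ covU _ lawY lawX indY indX _ nX nY nk delta
  delta0.
have nmin N : \forall k \near \oo, (N <= nX k)%N /\ (N <= nY k)%N.
  by move/cvgryPge : nk => /(_ N%:R); apply: filterS => k; exact: leq_harmonic.
have nXy : nX k @[k --> \oo] --> \oo.
  by move=> A [N _ NA]; apply: filterS (nmin N) => k [kX kY]; exact: NA.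
have nYy : nY k @[k --> \oo] --> \oo.
  by move=> A [N _ NA]; apply: filterS (nmin N) => k [kX kY]; exact: NA.
have [h0 h00 hX] := excess_dot_bound X2 covU.
pose aX (q : 'rV[R]_p) (z : p.-tuple R) := dot (rowt z) q.
pose lX (z : p.-tuple R) := \sum_(j < p) `|rowt z 0 j|.
(* The index is a dummy, taken in the compact set {0}. *)
pose aY (_ : R) (z : R) := z.
pose sphere := [set q : 'rV[R]_p | enorm q = 1].
have maX q : measurable_fun setT (aX q) by exact: measurable_dot.
have mlX : measurable_fun setT lX by exact: measurable_l1.
have aX2 q : aX q \o X \in Lfun P 2%:E by exact: dot_Lfun2.
have lX2 : lX \o X \in Lfun P 2%:E by exact: l1_Lfun2.
have alX q z : sphere q -> `|aX q z| <= lX z by exact: dot_sphere_le.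
have maY v : measurable_fun setT (aY v) by exact: measurable_id.
have mlY : measurable_fun setT (fun z : R => `|z|) by exact: measurableT_comp.
have Y2' : (Y : T -> R) \in Lfun P 2%:E.
  apply: Lfun2P => //; apply/integrableP; split.
    by apply/measurable_EFinP; exact: measurable_funX.
  move: Y2; rewrite unlock; apply: le_lt_trans.
  rewrite le_eqVlt; apply/orP; left; apply/eqP; apply: eq_integral => w _ /=.
  by rewrite ger0_norm// sqr_ge0.
have aY2 v : aY v \o Y \in Lfun P 2%:E by exact: Y2'.
have lY2 : (fun z : R => `|z|) \o Y \in Lfun P 2%:E.
  by apply: (Lfun2_dominated _ Y2') => [|w];
    [exact: measurableT_comp|rewrite /= normr_id].
have lipY (v v' r z : R) : ball v r v' -> `|aY v z - aY v' z| <= `|z| * r.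
  by move=> vv'; rewrite subrr normr0 mulr_ge0// (le_trans _ (ltW vv')).
have alY v z : [set (0 : R)] v -> `|aY v z| <= `|z| by [].
pose K := Num.max (pop_excess Y aY 0 0) (2 * \int[P]_x lX (X x)).
have YK : pop_excess Y aY 0 0 <= K by rewrite le_max lexx.
have XK q : sphere q -> h0 <= pop_excess X aX q 0 <= K.
  move=> q1; apply/andP; split; first exact: hX.
  rewrite le_max; apply/orP; right.
  exact: (pop_excess_le (K := sphere)).
have K0 : 0 <= K.
  by apply: le_trans YK; apply: Rintegral_ge0 => w _; rewrite le_max lexx orbT.
pose c0 := 2 / (eps * h0) + 2 * K / (eps * h0) ^+ 2.
have eh : 0 < eps * h0 by rewrite mulr_gt0.
have c00 : 0 < c0.
  apply: ltr_wpDr; last exact: divr_gt0.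
  by apply: divr_ge0; [exact: mulr_ge0|exact: sqr_ge0].
(* The first two bounds are the conditions of [Seps_close]; the third brings its error [eta * c0]
   below [delta]. *)
pose eta := Num.min 1 (Num.min (eps * h0 / 2) (delta / c0)).
have eta0 : 0 < eta by rewrite !lt_min ltr01 !divr_gt0.
have eta1 : eta <= 1 by rewrite ge_min lexx.
have etah : eta <= eps * h0 / 2 by rewrite !ge_min lexx orbT.
have etad : eta * c0 <= delta by rewrite -ler_pdivlMr// !ge_min lexx !orbT.
pose M := (K + 1) / eps.
have eM : eps * M = K + 1 by rewrite /M mulrC divfK// gt_eqF.
have cK0 : compact [set (0 : R)] by exact: compact_set1.
have NY := uniform_excess lawY indY cK0 maY mlY aY2 lY2 lipY alY M eta0.
have NX := uniform_excess lawX indX sphere_compact maX mlX aX2 lX2 (@dot_lip _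
  _) alX M eta0.
apply: outer_null_sub (outer_nullU (outer_null_comp nYy NY) (outer_null_comp
  nXy NX)).
apply: filterS (nmin 1) => k [kX kY] w /=.
apply: contraPP => /not_orP[nBY nBX]; apply/negP; rewrite -leNgt.
have closeY c : `|c| <= M ->
    `|pop_excess Y aY 0 c - emp_excess Ys aY (nY k) w 0 c| <= eta.
  by move=> cM; rewrite leNgt; apply/negP => bad; apply: nBY; exists 0, c;
    split.
have closeX q c : enorm q = 1 -> `|c| <= M ->
    `|pop_excess X aX q c - emp_excess Xs aX (nX k) w q c| <= eta.
  by move=> q1 cM; rewrite leNgt; apply/negP => bad; apply: nBX; exists q, c;
    split.
have dY : tail_dual (cdfR (centered P Y : {RV P >-> R})) (pop_excess Y aY 0).
  apply: (tail_dual_pop aY2) => x.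
  by rewrite -[LHS]/(Y x - fine 'E_P[Y]) expectation.unlock.
have dX q : tail_dual (cdfR (center_dot P X q : {RV P >-> R})) (pop_excess X aX
  q).
  by apply: (tail_dual_pop aX2) => x; exact: center_dotE.
(* Both sample sizes are positive by [nmin 1]; as successors they fit the empirical laws. *)
move: (nX k) (nY k) kX kY closeX closeY => [//|m] [//|m'] _ _ closeX closeY.
have dY' : tail_dual (fun t => ecdf m'.+1 (fun i => Ys i w)
    (t + smean m'.+1 ((fun i => Ys i w) : nat ->
      R^o))) (emp_excess Ys aY m'.+1 w 0).
  by apply: tail_dual_emp.
have dX' q : tail_dual (fun t => ecdf m.+1 (fun i => dot (rowt (Xs i w)) q)
    (t + dot (smean m.+1 (fun i =>
      rowt (Xs i w))) q)) (emp_excess Xs aX m.+1 w q).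
  by apply: tail_dual_emp => t; rewrite dot_smean.
apply: hausdorff_Bset_le; first exact: ltW.
move=> q q1; split.
- exact: (Seps_ge0 eps0 eps1 dY (dX q)).
- exact: (Seps_ge0 eps0 eps1 dY' (dX' q)).
- apply: le_trans etad.
  apply: (Seps_close eps0 eps1 dY (dX q) dY' (dX' q) h00 YK (XK q q1) eM eta1
    etah closeY).
  by move=> c; exact: closeX.
Qed.
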